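(* We have $$\sum_{k=2}^\infty\left\lfloor\frac{k}{2}\right\rfloor(\zeta(k)-1)=\frac{9+2\pi^2}{24},$$ $$\sum_{k=2}^\infty\left\lfloor\frac{k}{2}\right\rfloor\frac{\zeta(k)-1}{k}=\frac{2\gamma+\ln(2)}{4},$$ $$\sum_{k=2}^\infty\left\lfloor\frac{k}{2}\right\rfloor\frac{\zeta(k)-1}{k\,2^k}=\frac{\gamma+\ln(6)-2}{4},$$ and $$\sum_{k=2}^\infty\left\lfloor\frac{k}{2}\right\rfloor\frac{\zeta(k)-1}{k\,2^{2k}}=\frac12\left(\ln\Gamma\left(\frac14\right)+\frac{\gamma}{4}+\operatorname{arctanh}\left(\frac14\right)-\frac{\pi}{8}-\frac13-\frac12\ln(2\pi)\right).$$
   Context: $\lfloor x\rfloor$ denotes the floor function, $\zeta(z)=\sum_{n=1}^\infty n^{-z}$ ($\Re(z)>1$) is the Riemann zeta function, $\Gamma$ is the Gamma function, $\operatorname{arctanh}$ is the inverse hyperbolic tangent, and $\gamma=\lim_{n\to\infty}\left(\sum_{k=1}^n\frac1k-\ln n\right)$ is the Euler-Mascheroni constant. *)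

(* Defs.v *)
From Stdlib Require Import Reals Lra.
From Coquelicot Require Import Coquelicot.
Open Scope R_scope.

(* The Riemann zeta function at real arguments [s > 1].  The index of [Series]
   starts at 0, hence the shift. *)
Definition zeta (s : R) : R :=
  Series (fun n : nat => Rpower (INR (n + 1)) (- s)).

(* Euler's integral, improper at both ends; meaningful for [x > 0]. *)
Definition Gamma (x : R) : R :=
  RInt_gen (fun t => Rpower t (x - 1) * exp (- t))
    (at_right 0) (Rbar_locally p_infty).

(* The Euler-Mascheroni constant. *)
Definition euler_gamma : R :=
  real (Lim_seq (fun n : nat => sum_n_m (fun k => 1 / INR k) 1 n - ln (INR n))).

(* [tanh_arctanh] and [arctanh_tanh] show that this is the inverse of [tanh]. *)
Definition arctanh (x : R) : R := ln ((1 + x) / (1 - x)) / 2.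

Lemma tanh_eq (y : R) : tanh y = (exp (2 * y) - 1) / (exp (2 * y) + 1).
Proof.
  unfold tanh, sinh, cosh.
  replace (2 * y) with (y + y) by ring.
  rewrite exp_plus, exp_Ropp.
  pose proof (exp_pos y).
  field; repeat split; nra.
Qed.

Lemma tanh_arctanh (x : R) : -1 < x < 1 -> tanh (arctanh x) = x.
Proof.
  intros Hx; rewrite tanh_eq; unfold arctanh.
  replace (2 * (ln ((1 + x) / (1 - x)) / 2)) with (ln ((1 + x) / (1 - x)))
    by field.
  rewrite exp_ln by (apply Rdiv_lt_0_compat; lra).
  field; split; lra.
Qed.

Lemma arctanh_tanh (y : R) : arctanh (tanh y) = y.
Proof.
  rewrite tanh_eq; unfold arctanh.
  pose proof (exp_pos (2 * y)).
  replace ((1 + (exp (2 * y) - 1) / (exp (2 * y) + 1)) /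
           (1 - (exp (2 * y) - 1) / (exp (2 * y) + 1))) with (exp (2 * y)).
  - rewrite ln_exp; field.
  - field; split; lra.
Qed.

(* Main.v *)
Require Import Defs.
From Stdlib Require Import Reals Zfloor Lra Lia Factorial.
From Coquelicot Require Import Coquelicot.
Open Scope R_scope.

(** Write [zeta k - 1] as the sum of [1 / n ^ k] over [n >= 2].  All terms being
    nonnegative, the sum over [k] of [w k * x ^ k * (zeta k - 1)] is the sum over
    [n >= 2] of [g (x / n)], where [g] is the generating function of the weights
    [w] ([is_series_swap], [sum_weighted_zeta_minus_1]).  For [w k = floor (k / 2)]
    it is [y ^ 2 / ((1 - y) ^ 2 * (1 + y))]; for [w k = floor (k / 2) / k],
    integration gives [y / (2 (1 - y)) + ln ((1 - y) / (1 + y)) / 4]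
    ([is_series_div2], [is_series_div2_over]).  The four claims are then the values
    at [x = 1] of the first sum, and at [x = 1], [1 / 2], [1 / 4] of the second.

    The first one splits into a Basel series and a telescoping series.  In the next
    two the logarithms telescope, and the rational terms form harmonic sums over all
    or over odd denominators, whose asymptotics involve [euler_gamma]
    ([euler_gamma_lim], [odd_harmonic_lim]).  In the last one the denominators
    [4 n - 1] call for the Leibniz series besides the odd harmonic sum, and the
    logarithms form the product of [(1 - 1 / (4 n)) / (1 + 1 / (4 n))], which is the
    product of [1 - 1 / (4 n) ^ 2] divided by the square of the product of
    [1 + 1 / (4 n)].

    The numerator is the product for [sin (PI / 4)] ([sine_product]).  It is obtained,
    together with the Basel sum ([Basel]), from a single integration by parts for
    integrals of [v x * cos x ^ n] over [0, PI / 2] ([cos_moment_parts]), with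
    [v x = cos (2 z x)] and [v x = x ^ 2] respectively, as [cos x ^ n] concentrates
    at [0].  The denominator is Gauss's limit for [Gamma (1 / 4)]
    ([ln_Gamma_limit]): the functional equation expresses the product through
    [Gamma (n + 1 / 4)], which is compared with [Gamma n] by integrating the tangent
    line inequality for the concave function [t ^ p] ([Gamma_shift_le]). *)

(** * Series and limits *)

Lemma is_series_partial_sums (a u : nat -> R) (l : R) :
  (forall n, u n = sum_n a n) -> is_lim_seq u l -> is_series a l.
Proof. intros Hu Hl; exact (is_lim_seq_ext u (sum_n a) l Hu Hl). Qed.

(** Extensionality with the equation read in [R] itself rather than in the
    carrier of a normed module, so that [ring] and [field] apply to it. *)
Lemma is_series_ext_R (a b : nat -> R) (l : R) :
  (forall n, a n = b n) -> is_series a l -> is_series b l.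
Proof. apply is_series_ext. Qed.

Lemma is_series_drop_2 (a : nat -> R) (l : R) :
  a 0%nat = 0 -> a 1%nat = 0 -> is_series a l -> is_series (fun j => a (j + 2)%nat) l.
Proof.
  intros H0 H1 Ha.
  apply (is_series_ext (fun j => a (S (S j)))).
  { intros j; now replace (j + 2)%nat with (S (S j)) by lia. }
  apply (is_series_incr_1 (fun j => a (S j))), (is_series_incr_1 a).
  rewrite H0, H1; change plus with Rplus; now rewrite !Rplus_0_r.
Qed.

Lemma is_lim_seq_inv_INR_S : is_lim_seq (fun n => / INR (S n)) 0.
Proof.
  apply -> (is_lim_seq_incr_1 (fun n => / INR n)).
  apply (is_lim_seq_inv INR p_infty); [apply is_lim_seq_INR|discriminate].
Qed.

Lemma is_lim_seq_inv_shift (c : R) : 0 < c -> is_lim_seq (fun n => / (INR n + c)) 0.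
Proof.
  intros Hc; apply (is_lim_seq_inv (fun n => INR n + c) p_infty); [|discriminate].
  apply (is_lim_seq_plus INR (fun _ => c) p_infty c);
    [apply is_lim_seq_INR|apply is_lim_seq_const|easy].
Qed.

Lemma ln_le_sub_1 (u : R) : 0 < u -> ln u <= u - 1.
Proof.
  intros Hu; pose proof (exp_ineq1_le (ln u)) as H; rewrite exp_ln in H; lra.
Qed.

Lemma ln_diff_le (u v : R) : 0 < u -> 0 < v -> ln u - ln v <= (u - v) / v.
Proof.
  intros Hu Hv; rewrite <- ln_div by assumption.
  replace ((u - v) / v) with (u / v - 1) by (field; lra).
  apply ln_le_sub_1, Rdiv_lt_0_compat; assumption.
Qed.

(** The partial sums below produce logarithms of various shifts of the index;
    this lets each of them be compared with whichever shift is convenient. *)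
Lemma ln_shift_lim (a b : R) :
  0 < a -> 0 < b -> is_lim_seq (fun n => ln (INR n + a) - ln (INR n + b)) 0.
Proof.
  intros Ha Hb.
  apply (is_lim_seq_le_le (fun n => (a - b) * / (INR n + a)) _
           (fun n => (a - b) * / (INR n + b))).
  - intros n; pose proof (pos_INR n).
    pose proof (ln_diff_le (INR n + a) (INR n + b) ltac:(lra) ltac:(lra)) as H1.
    pose proof (ln_diff_le (INR n + b) (INR n + a) ltac:(lra) ltac:(lra)) as H2.
    unfold Rdiv in H1, H2.
    replace (INR n + a - (INR n + b)) with (a - b) in H1 by ring.
    replace (INR n + b - (INR n + a)) with (- (a - b)) in H2 by ring.
    lra.
  - replace (Finite 0) with (Finite ((a - b) * 0)) by (f_equal; ring).
    apply (is_lim_seq_scal_l _ (a - b) 0); now apply is_lim_seq_inv_shift.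
  - replace (Finite 0) with (Finite ((a - b) * 0)) by (f_equal; ring).
    apply (is_lim_seq_scal_l _ (a - b) 0); now apply is_lim_seq_inv_shift.
Qed.

(** * Interchange of nonnegative double series *)

Lemma sum_n_nonneg_le_series (a : nat -> R) (l : R) (N : nat) :
  (forall n, 0 <= a n) -> is_series a l -> sum_n a N <= l.
Proof.
  intros Ha Hl.
  apply (is_lim_seq_incr_compare (sum_n a) l Hl).
  intros n; rewrite sum_Sn; unfold plus; simpl.
  specialize (Ha (S n)); lra.
Qed.

Lemma is_series_le (a b : nat -> R) (la lb : R) :
  (forall n, a n <= b n) -> is_series a la -> is_series b lb -> la <= lb.
Proof.
  intros Hab Ha Hb.
  apply (is_lim_seq_le (sum_n a) (sum_n b) la lb); [|exact Ha|exact Hb].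
  intros n; apply sum_n_m_le, Hab.
Qed.

Lemma is_series_sum_n (a : nat -> nat -> R) (c : nat -> R) (K : nat) :
  (forall k, is_series (fun n => a n k) (c k)) ->
  is_series (fun n => sum_n (a n) K) (sum_n c K).
Proof.
  intros Hc; induction K as [|K IH].
  - rewrite sum_O.
    apply (is_series_ext (fun n => a n 0%nat)); [|apply Hc].
    intros n; symmetry; apply sum_O.
  - rewrite sum_Sn.
    apply (is_series_ext (fun n => plus (sum_n (a n) K) (a n (S K)))).
    + intros n; symmetry; apply sum_Sn.
    + apply (is_series_plus (fun n => sum_n (a n) K) (fun n => a n (S K)));
        [exact IH|apply Hc].
Qed.

(** A finite sum of columns is the series, over the rows, of truncated row sums,
    and truncation only decreases a sum of nonnegative terms. *)
Lemma sum_columns_le_sum_rows (a : nat -> nat -> R) (b c : nat -> R) (S : R) (K : nat) :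
  (forall n k, 0 <= a n k) ->
  (forall n, is_series (fun k => a n k) (b n)) ->
  (forall k, is_series (fun n => a n k) (c k)) ->
  is_series b S -> sum_n c K <= S.
Proof.
  intros Ha Hb Hc HS.
  apply (is_series_le (fun n => sum_n (a n) K) b); [|now apply is_series_sum_n|exact HS].
  intros n; now apply sum_n_nonneg_le_series.
Qed.

(** Tonelli for series.  The partial sums of [c] increase and stay below [S], so
    they have a limit [T]; applying the same bound to the transposed array gives
    [S <= T]. *)
Lemma is_series_swap (a : nat -> nat -> R) (b c : nat -> R) (S : R) :
  (forall n k, 0 <= a n k) ->
  (forall n, is_series (fun k => a n k) (b n)) ->
  (forall k, is_series (fun n => a n k) (c k)) ->
  is_series b S -> is_series c S.
Proof.
  intros Ha Hb Hc HS.
  assert (Hc0 : forall k, 0 <= c k).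
  { intros k; apply Rle_trans with (sum_n (fun n => a n k) 0).
    - rewrite sum_O; apply Ha.
    - apply sum_n_nonneg_le_series; auto. }
  assert (Hle : forall K, sum_n c K <= S)
    by (intros K; now apply (sum_columns_le_sum_rows a b)).
  assert (HT : ex_finite_lim_seq (sum_n c)).
  { apply ex_finite_lim_seq_incr with S; [|exact Hle].
    intros n; rewrite sum_Sn; unfold plus; simpl.
    specialize (Hc0 (Datatypes.S n)); lra. }
  destruct HT as [T HT].
  replace S with T; [exact HT|].
  apply Rle_antisym.
  - apply (is_lim_seq_le (sum_n c) (fun _ => S) T S);
      [exact Hle|exact HT|apply is_lim_seq_const].
  - apply (is_lim_seq_le (sum_n b) (fun _ => T) S T);
      [|exact HS|apply is_lim_seq_const].
    intros N; apply (sum_columns_le_sum_rows (fun k n => a n k) c b); auto.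
Qed.

(** * Integrals against powers of the cosine *)

Definition cos_moment (v : R -> R) (n : nat) : R :=
  RInt (fun x => cos x ^ n * v x) 0 (PI / 2).

Lemma continuous_cos_pow (n : nat) (v : R -> R) (x : R) :
  continuous v x -> continuous (fun x => cos x ^ n * v x) x.
Proof.
  intros Hv; apply (continuous_mult (fun x => cos x ^ n)); [|exact Hv].
  apply (ex_derive_continuous (fun x => cos x ^ n)); auto_derive; easy.
Qed.

Lemma is_RInt_cos_moment (v : R -> R) (n : nat) :
  (forall x, continuous v x) ->
  is_RInt (fun x => cos x ^ n * v x) 0 (PI / 2) (cos_moment v n).
Proof.
  intros Hv.
  apply (@RInt_correct R_CompleteNormedModule), (@ex_RInt_continuous R_CompleteNormedModule).
  intros x _; apply continuous_cos_pow, Hv.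
Qed.

(** Green's formula for [cos ^ (n + 2)] and [v]: the primitive
    [(cos ^ (n + 2))' * v - cos ^ (n + 2) * v'] vanishes at [PI / 2] because of
    the cosine, and at [0] because [sin 0 = 0] and [v' 0 = 0].  The constant
    function, the square and [cos (a x)] all satisfy this last condition, which
    gives the Wallis, Basel and sine product recurrences at once. *)
Lemma cos_moment_parts (v v' v'' : R -> R) (n : nat) :
  (forall x, is_derive v x (v' x)) -> (forall x, is_derive v' x (v'' x)) ->
  (forall x, continuous v'' x) -> v' 0 = 0 ->
  cos_moment v'' (n + 2) =
  INR (n + 2) * INR (n + 1) * cos_moment v n - INR (n + 2) ^ 2 * cos_moment v (n + 2).
Proof.
  intros Hv Hv' Hv'' H0.
  assert (Hcv : forall x, continuous v x).
  { intros x; apply (ex_derive_continuous v); eexists; apply Hv. }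
  set (df := fun x => INR (n + 2) * INR (n + 1) * (cos x ^ n * v x)
                      - INR (n + 2) ^ 2 * (cos x ^ (n + 2) * v x)
                      - cos x ^ (n + 2) * v'' x).
  set (F := fun x => - INR (n + 2) * (cos x ^ (n + 1) * sin x) * v x
                     - cos x ^ (n + 2) * v' x).
  assert (HF : is_RInt df 0 (PI / 2) (minus (F (PI / 2)) (F 0))).
  { apply (is_RInt_derive F df).
    - intros x _; unfold F, df.
      evar_last.
      + apply (is_derive_minus
                 (fun x => - INR (n + 2) * (cos x ^ (n + 1) * sin x) * v x)
                 (fun x => cos x ^ (n + 2) * v' x)).
        * apply (is_derive_mult (fun x => - INR (n + 2) * (cos x ^ (n + 1) * sin x)) v);
            [|apply Hv|exact Rmult_comm].
          auto_derive; [easy|reflexivity].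
        * apply (is_derive_mult (fun x => cos x ^ (n + 2)) v');
            [|apply Hv'|exact Rmult_comm].
          auto_derive; [easy|reflexivity].
      + unfold minus, plus, opp, mult; simpl; unfold mult; simpl.
        replace (Init.Nat.pred (n + 1)) with n by lia.
        replace (Init.Nat.pred (n + 2)) with (S n) by lia.
        replace (n + 2)%nat with (S (S n)) by lia.
        replace (n + 1)%nat with (S n) by lia.
        rewrite !S_INR; cbn [pow].
        pose proof (sin2_cos2 x) as Hsc; unfold Rsqr in Hsc.
        replace (cos x * (cos x * cos x ^ n)) with ((1 - sin x * sin x) * cos x ^ n)
          by (rewrite <- Hsc; ring).
        ring_simplify.
        replace (cos x ^ 2) with (1 - sin x ^ 2) by (rewrite <- Hsc; ring).
        ring.
    - intros x _; unfold df.
      apply (continuous_minus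
               (fun x => INR (n + 2) * INR (n + 1) * (cos x ^ n * v x)
                      - INR (n + 2) ^ 2 * (cos x ^ (n + 2) * v x))
               (fun x => cos x ^ (n + 2) * v'' x));
        [apply (continuous_minus
                  (fun x => INR (n + 2) * INR (n + 1) * (cos x ^ n * v x))
                  (fun x => INR (n + 2) ^ 2 * (cos x ^ (n + 2) * v x)))|].
      + apply (continuous_scal_r (INR (n + 2) * INR (n + 1)) (fun x => cos x ^ n * v x)).
        apply continuous_cos_pow, Hcv.
      + apply (continuous_scal_r (INR (n + 2) ^ 2) (fun x => cos x ^ (n + 2) * v x)).
        apply continuous_cos_pow, Hcv.
      + apply continuous_cos_pow, Hv''. }
  assert (HL : is_RInt df 0 (PI / 2)
    (INR (n + 2) * INR (n + 1) * cos_moment v n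
     - INR (n + 2) ^ 2 * cos_moment v (n + 2) - cos_moment v'' (n + 2))).
  { apply (is_RInt_minus (fun x => INR (n + 2) * INR (n + 1) * (cos x ^ n * v x)
                      - INR (n + 2) ^ 2 * (cos x ^ (n + 2) * v x))
               (fun x => cos x ^ (n + 2) * v'' x));
      [apply (is_RInt_minus
                (fun x => INR (n + 2) * INR (n + 1) * (cos x ^ n * v x))
                (fun x => INR (n + 2) ^ 2 * (cos x ^ (n + 2) * v x)))|].
    - apply (is_RInt_scal (fun x => cos x ^ n * v x)), is_RInt_cos_moment, Hcv.
    - apply (is_RInt_scal (fun x => cos x ^ (n + 2) * v x)), is_RInt_cos_moment, Hcv.
    - apply is_RInt_cos_moment, Hv''. }
  pose proof (is_RInt_unique _ _ _ _ HF) as E.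
  rewrite (is_RInt_unique _ _ _ _ HL) in E.
  assert (HF0 : minus (F (PI / 2)) (F 0) = 0).
  { unfold F; rewrite cos_PI2, sin_0, H0, !pow_ne_zero by lia.
    unfold minus, plus, opp; simpl; ring. }
  rewrite HF0 in E; lra.
Qed.

Lemma cos_moment_le (v w : R -> R) (n p : nat) :
  (forall x, continuous v x) -> (forall x, continuous w x) ->
  (forall x, 0 < x < PI / 2 -> cos x ^ n * v x <= cos x ^ p * w x) ->
  cos_moment v n <= cos_moment w p.
Proof.
  intros Hv Hw Hle.
  apply (is_RInt_le (fun x => cos x ^ n * v x) (fun x => cos x ^ p * w x) 0 (PI / 2)).
  - pose proof PI_RGT_0; lra.
  - now apply is_RInt_cos_moment.
  - now apply is_RInt_cos_moment.
  - exact Hle.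
Qed.

Definition Wallis (m : nat) : R := cos_moment (fun _ => 1) (2 * m).

Lemma Wallis_0 : Wallis 0 = PI / 2.
Proof.
  unfold Wallis, cos_moment.
  rewrite (RInt_ext _ (fun _ => 1)).
  2: { intros x _; change (2 * 0)%nat with 0%nat; rewrite pow_O; apply Rmult_1_l. }
  rewrite RInt_const; unfold scal; simpl; unfold mult; simpl; ring.
Qed.

Lemma Wallis_S (m : nat) :
  INR (2 * m + 2) * Wallis (S m) = INR (2 * m + 1) * Wallis m.
Proof.
  pose proof (cos_moment_parts (fun _ => 1) (fun _ => 0) (fun _ => 0) (2 * m)) as H.
  assert (E : cos_moment (fun _ => 0) (2 * m + 2) = 0).
  { unfold cos_moment.
    rewrite (RInt_ext _ (fun _ => 0)) by (intros; apply Rmult_0_r).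
    rewrite RInt_const; unfold scal; simpl; unfold mult; simpl; ring. }
  rewrite E in H; unfold Wallis; replace (2 * S m)%nat with (2 * m + 2)%nat by lia.
  apply Rmult_eq_reg_l with (INR (2 * m + 2)); [|apply not_0_INR; lia].
  assert (0 = INR (2 * m + 2) * INR (2 * m + 1) * cos_moment (fun _ => 1) (2 * m)
              - INR (2 * m + 2) ^ 2 * cos_moment (fun _ => 1) (2 * m + 2)).
  { apply H; try easy; intros x.
    - auto_derive; easy.
    - auto_derive; easy.
    - apply continuous_const. }
  lra.
Qed.

Lemma Wallis_pos (m : nat) : 0 < Wallis m.
Proof.
  induction m as [|m IH].
  - rewrite Wallis_0; pose proof PI_RGT_0; lra.
  - apply Rmult_lt_reg_l with (INR (2 * m + 2)); [apply lt_0_INR; lia|].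
    rewrite Wallis_S, Rmult_0_r; apply Rmult_lt_0_compat; [apply lt_0_INR; lia|exact IH].
Qed.

(** The average of [v] for the probability density proportional to
    [cos x ^ (2 m)] on [0, PI / 2], which concentrates at [0] as [m] grows. *)
Definition Wallis_mean (v : R -> R) (m : nat) : R := cos_moment v (2 * m) / Wallis m.

Lemma Wallis_mean_const (c : R) (m : nat) : Wallis_mean (fun _ => c) m = c.
Proof.
  unfold Wallis_mean.
  assert (E : cos_moment (fun _ => c) (2 * m) = c * Wallis m).
  { apply is_RInt_unique.
    apply (is_RInt_ext (fun x => scal c (cos x ^ (2 * m) * 1))).
    - intros x _; unfold scal; cbn -[pow Nat.mul]; unfold mult; cbn -[pow Nat.mul]; ring.
    - apply (is_RInt_scal (fun x => cos x ^ (2 * m) * 1)).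
      apply (is_RInt_cos_moment (fun _ => 1)); intros; apply continuous_const. }
  rewrite E; pose proof (Wallis_pos m); field; lra.
Qed.

Lemma Wallis_mean_parts (v v' v'' : R -> R) (m : nat) :
  (forall x, is_derive v x (v' x)) -> (forall x, is_derive v' x (v'' x)) ->
  (forall x, continuous v'' x) -> v' 0 = 0 ->
  Wallis_mean v'' (S m) = (2 * INR (S m)) ^ 2 * (Wallis_mean v m - Wallis_mean v (S m)).
Proof.
  intros Hv Hv' Hv'' H0; unfold Wallis_mean.
  replace (2 * S m)%nat with (2 * m + 2)%nat by lia.
  rewrite (cos_moment_parts v v' v'') by assumption.
  replace (2 * INR (S m)) with (INR (2 * m + 2))
    by (rewrite S_INR, plus_INR, mult_INR; simpl; ring).
  pose proof (Wallis_pos m); pose proof (Wallis_pos (S m)).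
  assert (0 < INR (2 * m + 1)) by (apply lt_0_INR; lia).
  assert (0 < INR (2 * m + 2)) by (apply lt_0_INR; lia).
  replace (Wallis m) with (INR (2 * m + 2) * Wallis (S m) / INR (2 * m + 1))
    by (rewrite Wallis_S; field; lra).
  field; lra.
Qed.

Lemma x_cos_le_sin (x : R) : 0 <= x <= PI / 2 -> x * cos x <= sin x.
Proof.
  intros Hx.
  destruct (MVT_gen (fun x => sin x - x * cos x) 0 x (fun x => x * sin x)) as [c [Hc E]].
  - intros t _; auto_derive; [easy|ring].
  - intros t _; apply continuity_pt_filterlim.
    apply (ex_derive_continuous (fun x => sin x - x * cos x)); auto_derive; easy.
  - rewrite Rmin_left, Rmax_right in Hc by lra.
    rewrite sin_0 in E.
    assert (0 <= sin c) by (apply sin_ge_0; lra).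
    assert (0 <= c * sin c * (x - 0)) by (repeat apply Rmult_le_pos; lra).
    lra.
Qed.

Definition mean_sq : nat -> R := Wallis_mean (fun x => x ^ 2).

Lemma continuous_sq (x : R) : continuous (fun x => x ^ 2) x.
Proof. apply (@ex_derive_continuous R_AbsRing R_NormedModule); auto_derive; easy. Qed.

(** From [x cos x <= sin x], the second moment for [cos ^ (2 m + 2)] is at most
    the integral of [cos ^ (2 m) * sin ^ 2], a difference of consecutive Wallis
    integrals, hence small compared with either. *)
Lemma mean_sq_bounds (m : nat) : 0 <= mean_sq (S m) <= / INR (2 * m + 1).
Proof.
  pose proof (Wallis_pos m); pose proof (Wallis_pos (S m)).
  assert (0 < INR (2 * m + 1)) by (apply lt_0_INR; lia).
  pose proof (Wallis_S m) as HW.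
  assert (E2 : INR (2 * m + 2) = INR (2 * m + 1) + 1)
    by (rewrite !plus_INR; simpl; ring).
  unfold mean_sq, Wallis_mean; split.
  - apply Rdiv_le_0_compat; [|assumption].
    apply RInt_ge_0.
    + pose proof PI_RGT_0; lra.
    + eexists; apply (is_RInt_cos_moment (fun x => x ^ 2)), continuous_sq.
    + intros x Hx; apply Rmult_le_pos; [|apply pow2_ge_0].
      apply pow_le, cos_ge_0; lra.
  - apply Rle_div_l; [assumption|].
    apply Rle_trans with (Wallis m - Wallis (S m)).
    + assert (Hs : Wallis m - Wallis (S m) = cos_moment (fun x => sin x ^ 2) (2 * m)).
      { symmetry; apply (is_RInt_unique).
        apply (is_RInt_ext (fun x => minus (cos x ^ (2 * m) * 1) (cos x ^ (2 * S m) * 1))).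
        - intros x _; unfold minus, plus, opp; simpl plus; cbn -[pow Nat.mul].
          replace (2 * S m)%nat with (2 * m + 2)%nat by lia.
          rewrite pow_add.
          pose proof (sin2_cos2 x) as Hsc; unfold Rsqr in Hsc.
          replace (sin x ^ 2) with (1 - cos x ^ 2) by (rewrite <- Hsc; ring).
          ring.
        - apply (is_RInt_minus (fun x => cos x ^ (2 * m) * 1) (fun x => cos x ^ (2 * S m) * 1));
            apply (is_RInt_cos_moment (fun _ => 1)); intros; apply continuous_const. }
      rewrite Hs; apply cos_moment_le.
      * apply continuous_sq.
      * intros x; apply (@ex_derive_continuous R_AbsRing R_NormedModule); auto_derive; easy.
      * intros x Hx.
        replace (2 * S m)%nat with (2 * m + 2)%nat by lia; rewrite pow_add.
        rewrite Rmult_assoc; apply Rmult_le_compat_l; [apply pow_le, cos_ge_0; lra|].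
        rewrite <- Rpow_mult_distr; apply pow_incr.
        assert (0 <= cos x) by (apply cos_ge_0; lra).
        split; [nra|]; rewrite Rmult_comm; apply x_cos_le_sin; lra.
    + rewrite E2 in HW.
      apply Rmult_le_reg_l with (INR (2 * m + 1)); [assumption|].
      replace (INR (2 * m + 1) * (/ INR (2 * m + 1) * Wallis (S m)))
        with (Wallis (S m)) by (field; lra).
      lra.
Qed.

Lemma mean_sq_lim : is_lim_seq mean_sq 0.
Proof.
  apply is_lim_seq_incr_1.
  apply (is_lim_seq_le_le (fun _ => 0) _ (fun m => / INR (S m)));
    [|apply is_lim_seq_const|apply is_lim_seq_inv_INR_S].
  intros m; destruct (mean_sq_bounds m) as [H1 H2]; split; [exact H1|].
  apply Rle_trans with (1 := H2).
  apply Rinv_le_contravar; [apply lt_0_INR; lia|apply le_INR; lia].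
Qed.

(** * Basel problem and sine product *)

(** Matsuoka's argument: the recurrence for the square reads
    [1 / (m + 1) ^ 2 = 2 (mean_sq m - mean_sq (m + 1))], so the series telescopes
    to [2 * mean_sq 0], and [mean_sq 0 = PI ^ 2 / 12] is the average of [x ^ 2]
    on the interval. *)
Lemma Basel : is_series (fun n => / INR (n + 1) ^ 2) (PI ^ 2 / 6).
Proof.
  assert (Hstep : forall m, / INR (m + 1) ^ 2 = 2 * (mean_sq m - mean_sq (S m))).
  { intros m.
    assert (0 < INR (S m)) by (apply lt_0_INR; lia).
    pose proof (Wallis_mean_parts (fun x => x ^ 2) (fun x => 2 * x) (fun _ => 2) m) as H2.
    rewrite Wallis_mean_const in H2.
    replace (m + 1)%nat with (S m) by lia; unfold mean_sq.
    apply Rmult_eq_reg_l with (2 * INR (S m) ^ 2); [|nra].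
    replace (2 * INR (S m) ^ 2 * / INR (S m) ^ 2) with 2 by (field; lra).
    rewrite H2 at 1.
    - ring.
    - intros x; auto_derive; [easy|ring].
    - intros x; auto_derive; [easy|ring].
    - intros x; apply continuous_const.
    - ring. }
  assert (E0 : mean_sq 0 = PI ^ 2 / 12).
  { unfold mean_sq, Wallis_mean; rewrite Wallis_0.
    assert (E : cos_moment (fun x => x ^ 2) (2 * 0) = PI ^ 3 / 24).
    { apply is_RInt_unique.
      apply (is_RInt_ext (fun x => x ^ 2)); [intros x _; simpl; ring|].
      replace (PI ^ 3 / 24) with (minus ((PI / 2) ^ 3 / 3) (0 ^ 3 / 3))
        by (unfold minus, plus, opp; simpl; field).
      apply (is_RInt_derive (fun x => x ^ 3 / 3)).
      - intros x _; auto_derive; [easy|field].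
      - intros x _; apply continuous_sq. }
    rewrite E; pose proof PI_RGT_0; field; lra. }
  apply (is_series_partial_sums _ (fun n => PI ^ 2 / 6 - 2 * mean_sq (S n))).
  - induction n as [|n IH].
    + rewrite sum_O, Hstep, E0; lra.
    + rewrite sum_Sn, <- IH, Hstep; change plus with Rplus; lra.
  - replace (Finite (PI ^ 2 / 6)) with (Finite (PI ^ 2 / 6 - 2 * 0)) by (f_equal; ring).
    apply is_lim_seq_minus'; [apply is_lim_seq_const|].
    apply (is_lim_seq_scal_l _ 2 0).
    apply -> (is_lim_seq_incr_1 mean_sq); apply mean_sq_lim.
Qed.

Lemma cos_lower (x : R) : 1 - x ^ 2 / 2 <= cos x.
Proof.
  replace (cos x) with (cos (2 * (x / 2))) by (f_equal; field).
  rewrite cos_2a_sin.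
  destruct (MVT_gen sin 0 (x / 2) cos) as [c [_ E]].
  - intros t _; apply is_derive_Reals, derivable_pt_lim_sin.
  - intros t _; apply continuity_sin.
  - rewrite sin_0, !Rminus_0_r in E; rewrite E.
    pose proof (COS_bound c); assert (cos c ^ 2 <= 1) by nra.
    pose proof (pow2_ge_0 x); nra.
Qed.

(** For [v x = cos (2 z x)] one has [v'' = - (2 z) ^ 2 v], so the averages of [v]
    satisfy a two-term recurrence with ratio [1 - z ^ 2 / (m + 1) ^ 2].  The
    average for [m = 0] is [sin (PI z) / (PI z)], and the averages tend to [v 0 = 1]
    since [1 - 2 z ^ 2 x ^ 2 <= v x <= 1]. *)
Lemma sine_product (z : R) :
  z <> 0 ->
  is_lim_seq (fun n => prod_f_R0 (fun i => 1 - (z / INR (i + 1)) ^ 2) n)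
    (sin (PI * z) / (PI * z)).
Proof.
  intros Hz.
  set (v := fun x => cos (2 * z * x)).
  pose proof PI_RGT_0.
  assert (Hcv : forall x, continuous v x).
  { intros x; apply (@ex_derive_continuous R_AbsRing R_NormedModule); unfold v; auto_derive; easy. }
  assert (Hstep : forall m,
    Wallis_mean v m = (1 - (z / INR (m + 1)) ^ 2) * Wallis_mean v (S m)).
  { intros m.
    assert (0 < INR (S m)) by (apply lt_0_INR; lia).
    pose proof (Wallis_mean_parts v (fun x => - (2 * z) * sin (2 * z * x))
                  (fun x => - (2 * z) ^ 2 * v x) m) as Hp.
    assert (Hlin : Wallis_mean (fun x => - (2 * z) ^ 2 * v x) (S m)
                   = - (2 * z) ^ 2 * Wallis_mean v (S m)).
    { unfold Wallis_mean, Rdiv; rewrite <- Rmult_assoc; f_equal.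
      apply is_RInt_unique.
      apply (is_RInt_ext (fun x => scal (- (2 * z) ^ 2) (cos x ^ (2 * S m) * v x))).
      - intros x _; unfold scal; cbn -[pow Nat.mul]; unfold mult; cbn -[pow Nat.mul]; ring.
      - apply (is_RInt_scal (fun x => cos x ^ (2 * S m) * v x)).
        apply is_RInt_cos_moment, Hcv. }
    rewrite Hlin in Hp.
    replace (m + 1)%nat with (S m) by lia.
    apply Rmult_eq_reg_l with ((2 * INR (S m)) ^ 2); [|nra].
    replace ((2 * INR (S m)) ^ 2 * ((1 - (z / INR (S m)) ^ 2) * Wallis_mean v (S m)))
      with ((2 * INR (S m)) ^ 2 * Wallis_mean v (S m) + - (2 * z) ^ 2 * Wallis_mean v (S m))
      by (field; lra).
    rewrite Hp.
    - ring.
    - intros x; unfold v; auto_derive; [easy|ring].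
    - intros x; unfold v; auto_derive; [easy|ring].
    - intros x; apply (continuous_scal_r (- (2 * z) ^ 2) v), Hcv.
    - rewrite Rmult_0_r, sin_0; ring. }
  assert (E0 : Wallis_mean v 0 = sin (PI * z) / (PI * z)).
  { unfold Wallis_mean; rewrite Wallis_0.
    assert (E : cos_moment v (2 * 0) = sin (PI * z) / (2 * z)).
    { apply is_RInt_unique.
      apply (is_RInt_ext v); [intros x _; simpl; ring|].
      replace (sin (PI * z) / (2 * z))
        with (minus (sin (2 * z * (PI / 2)) / (2 * z)) (sin (2 * z * 0) / (2 * z))).
      - apply (is_RInt_derive (fun x => sin (2 * z * x) / (2 * z))).
        + intros x _; unfold v; auto_derive; [easy|field; exact Hz].
        + intros x _; apply Hcv.
      - rewrite Rmult_0_r, sin_0.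
        replace (2 * z * (PI / 2)) with (PI * z) by field.
        unfold minus, plus, opp; simpl; field; exact Hz. }
    rewrite E; field; lra. }
  assert (Hprod : forall n, sin (PI * z) / (PI * z) =
    prod_f_R0 (fun i => 1 - (z / INR (i + 1)) ^ 2) n * Wallis_mean v (S n)).
  { induction n as [|n IH].
    - rewrite <- E0; apply Hstep.
    - rewrite IH, Hstep; cbn [prod_f_R0]; ring. }
  assert (Hq : is_lim_seq (fun n => Wallis_mean v (S n)) 1).
  { apply (is_lim_seq_le_le (fun n => 1 - 2 * z ^ 2 * mean_sq (S n)) _ (fun _ => 1)).
    - intros n; pose proof (Wallis_pos (S n)); unfold mean_sq, Wallis_mean; split.
      + assert (Hm : Wallis (S n) - 2 * z ^ 2 * cos_moment (fun x => x ^ 2) (2 * S n)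
                = cos_moment (fun x => 1 - 2 * z ^ 2 * x ^ 2) (2 * S n)).
        { symmetry; apply is_RInt_unique.
          apply (is_RInt_ext (fun x => minus (cos x ^ (2 * S n) * 1)
                   (scal (2 * z ^ 2) (cos x ^ (2 * S n) * x ^ 2)))).
          - intros x _; unfold minus, plus, opp, scal; cbn -[pow Nat.mul];
              unfold mult; cbn -[pow Nat.mul]; ring.
          - apply (is_RInt_minus (fun x => cos x ^ (2 * S n) * 1)
                   (fun x => scal (2 * z ^ 2) (cos x ^ (2 * S n) * x ^ 2))).
            + apply (is_RInt_cos_moment (fun _ => 1)); intros; apply continuous_const.
            + apply (is_RInt_scal (fun x => cos x ^ (2 * S n) * x ^ 2)).
              apply (is_RInt_cos_moment (fun x => x ^ 2)), continuous_sq. }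
        apply Rle_div_r; [assumption|].
        replace ((1 - 2 * z ^ 2 * (cos_moment (fun x => x ^ 2) (2 * S n) / Wallis (S n)))
                 * Wallis (S n))
          with (Wallis (S n) - 2 * z ^ 2 * cos_moment (fun x => x ^ 2) (2 * S n))
          by (field; lra).
        rewrite Hm; apply cos_moment_le.
        * intros x; apply (@ex_derive_continuous R_AbsRing R_NormedModule); auto_derive; easy.
        * exact Hcv.
        * intros x Hx; apply Rmult_le_compat_l; [apply pow_le, cos_ge_0; lra|].
          pose proof (cos_lower (2 * z * x)); unfold v; lra.
      + apply Rle_div_l; [assumption|]; rewrite Rmult_1_l.
        apply (cos_moment_le v (fun _ => 1)); [exact Hcv|intros; apply continuous_const|].
        intros x Hx; apply Rmult_le_compat_l; [apply pow_le, cos_ge_0; lra|].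
        apply COS_bound.
    - replace (Finite 1) with (Finite (1 - 2 * z ^ 2 * 0)) by (f_equal; ring).
      apply is_lim_seq_minus'; [apply is_lim_seq_const|].
      apply (is_lim_seq_scal_l _ (2 * z ^ 2) 0).
      apply -> (is_lim_seq_incr_1 mean_sq); apply mean_sq_lim.
    - apply is_lim_seq_const. }
  apply (is_lim_seq_ext_loc
           (fun n => sin (PI * z) / (PI * z) / Wallis_mean v (S n))).
  - apply is_lim_seq_spec in Hq; destruct (Hq (mkposreal 1 Rlt_0_1)) as [N HN].
    exists N; intros n Hn; specialize (HN n Hn); simpl in HN.
    apply Rabs_lt_between in HN.
    rewrite (Hprod n); field; lra.
  - replace (Finite (sin (PI * z) / (PI * z)))
      with (Rbar_div (sin (PI * z) / (PI * z)) 1) by (simpl; f_equal; field; lra).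
    apply is_lim_seq_div'; [apply is_lim_seq_const|exact Hq|lra].
Qed.

(** * Gamma function *)

Notation is_RInt_0_infty f l :=
  (is_RInt_gen f (at_right 0) (Rbar_locally p_infty) l).

Lemma filter_prod_0_infty (P : R * R -> Prop) (a0 b0 : R) :
  0 < a0 -> (forall a b, 0 < a < a0 -> b0 < b -> P (a, b)) ->
  filter_prod (at_right 0) (Rbar_locally p_infty) P.
Proof.
  intros Ha HP.
  apply (Filter_prod _ _ _ (fun a => 0 < a < a0) (fun b => b0 < b)).
  - exists (mkposreal a0 Ha); intros y Hy Hpos.
    change (Rabs (y - 0) < a0) in Hy. apply Rabs_lt_between in Hy; lra.
  - now exists b0.
  - exact HP.
Qed.

Lemma is_RInt_0_infty_le (f g : R -> R) (lf lg : R) :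
  is_RInt_0_infty f lf -> is_RInt_0_infty g lg ->
  (forall t, 0 < t -> f t <= g t) -> lf <= lg.
Proof.
  intros Hf Hg Hle.
  apply Rnot_lt_le; intros Hlt.
  assert (He : 0 < (lf - lg) / 2) by lra.
  pose (e := mkposreal _ He).
  pose proof (Hf _ (locally_ball lf e)) as Hf'.
  pose proof (Hg _ (locally_ball lg e)) as Hg'.
  assert (Hab : filter_prod (at_right 0) (Rbar_locally p_infty)
                  (fun ab => 0 < fst ab /\ fst ab <= snd ab)).
  { apply (filter_prod_0_infty _ 1 1); [lra|]; simpl; intros; lra. }
  unfold filtermapi in Hf', Hg'.
  pose proof (filter_and _ _ Hab (filter_and _ _ Hf' Hg')) as H.
  apply filter_ex in H.
  destruct H as [[a b] [[Ha Hb] [[y [Hy By]] [z [Hz Bz]]]]]; simpl in *.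
  assert (y <= z).
  { apply (is_RInt_le f g a b); auto; intros t Ht; apply Hle; lra. }
  change (Rabs (y - lf) < (lf - lg) / 2) in By.
  change (Rabs (z - lg) < (lf - lg) / 2) in Bz.
  apply Rabs_lt_between in By; apply Rabs_lt_between in Bz; lra.
Qed.

Lemma is_RInt_0_infty_primitive (F f : R -> R) (la lb : R) :
  (forall t, 0 < t -> is_derive F t (f t)) ->
  (forall t, 0 < t -> continuous f t) ->
  filterlim F (at_right 0) (locally la) ->
  filterlim F (Rbar_locally p_infty) (locally lb) ->
  is_RInt_0_infty f (lb - la).
Proof.
  intros HF Hf Hla Hlb P [eps HP].
  pose proof (Hla _ (locally_ball la (pos_div_2 eps))) as [da Ha].
  pose proof (Hlb _ (locally_ball lb (pos_div_2 eps))) as [db Hb].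
  apply (filter_prod_0_infty _ (Rmin da 1) (Rmax db 1)).
  { apply Rmin_pos; [apply cond_pos|lra]. }
  intros a b Ha' Hb'; simpl.
  pose proof (Rmin_l da 1); pose proof (Rmin_r da 1).
  pose proof (Rmax_l db 1); pose proof (Rmax_r db 1).
  exists (F b - F a); split.
  - apply (is_RInt_derive F f); intros t Ht;
      rewrite Rmin_left, Rmax_right in Ht by lra; [apply HF|apply Hf]; lra.
  - apply HP.
    assert (Ba : ball la (pos_div_2 eps) (F a)).
    { apply Ha; [|lra].
      change (Rabs (a - 0) < da); rewrite Rminus_0_r, Rabs_pos_eq; lra. }
    assert (Bb : ball lb (pos_div_2 eps) (F b)) by (apply Hb; lra).
    change (Rabs (F a - la) < eps / 2) in Ba; change (Rabs (F b - lb) < eps / 2) in Bb.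
    change (Rabs (F b - F a - (lb - la)) < eps).
    apply Rabs_lt_between in Ba; apply Rabs_lt_between in Bb.
    apply Rabs_lt_between; lra.
Qed.

(** The dominating function is given through a bounded primitive [F]: then
    [F] minus the integral of [f] increases, so the proper integrals of [f] are
    at most [M], and being monotone in both bounds they converge to their
    supremum. *)
Lemma ex_RInt_0_infty_dominated (f F : R -> R) (M : R) :
  (forall t, 0 < t -> continuous f t) -> (forall t, 0 < t -> 0 <= f t) ->
  (forall t, 0 < t -> exists d, is_derive F t d /\ f t <= d) ->
  (forall t, 0 < t -> 0 <= F t <= M) ->
  exists l, is_RInt_0_infty f l.
Proof.
  intros Hf Hpos HF HM.
  assert (Hex : forall a b, 0 < a -> a <= b -> ex_RInt f a b).
  { intros a b Ha Hab; apply (@ex_RInt_continuous R_CompleteNormedModule).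
    intros t Ht; rewrite Rmin_left in Ht by lra; apply Hf; lra. }
  assert (Hbd : forall a b, 0 < a -> a <= b -> RInt f a b <= M).
  { intros a b Ha Hab.
    assert (Hc : forall t, 0 < t -> continuous (RInt f a) t /\ is_derive (RInt f a) t (f t)).
    { intros t Ht.
      assert (Hd : is_derive (RInt f a) t (f t)).
      { apply (is_derive_RInt f (RInt f a) a t); [|apply Hf, Ht].
        exists (mkposreal t Ht); intros y Hy.
        change (Rabs (y - t) < t) in Hy; apply Rabs_lt_between in Hy.
        apply (@RInt_correct R_CompleteNormedModule).
        apply (@ex_RInt_continuous R_CompleteNormedModule).
        intros z Hz; apply Hf.
        assert (0 < Rmin a y) by (apply Rmin_pos; lra); lra. }
      split; [|exact Hd].
      apply (ex_derive_continuous (RInt f a)); now exists (f t). }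
    (* F minus the integral is nondecreasing *)
    destruct (MVT_gen (fun t => F t - RInt f a t) a b
                (fun t => Derive F t - f t)) as [c [Hc' E]].
    - intros t Ht; rewrite Rmin_left in Ht by lra.
      destruct (HF t) as [d [Hd _]]; [lra|].
      apply (is_derive_minus F (RInt f a)).
      + apply Derive_correct; now exists d.
      + apply Hc; lra.
    - intros t Ht; rewrite Rmin_left in Ht by lra.
      destruct (HF t) as [d [Hd _]]; [lra|].
      apply continuity_pt_filterlim.
      apply (continuous_minus F (RInt f a)).
      + apply (ex_derive_continuous F); now exists d.
      + apply Hc; lra.
    - rewrite Rmin_left in Hc' by lra.
      destruct (HF c) as [d [Hd Hle]]; [lra|].
      rewrite (is_derive_unique _ _ _ Hd) in E.
      assert (H0 : RInt f a a = 0) by apply (@RInt_point R_CompleteNormedModule).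
      rewrite H0 in E.
      assert (0 <= (d - f c) * (b - a)) by (apply Rmult_le_pos; lra).
      pose proof (HM a Ha); pose proof (HM b); lra. }
  destruct (completeness (fun y => exists a b, 0 < a /\ a <= b /\ y = RInt f a b))
    as [l [Hub Hlub]].
  - exists M; intros y [a [b [Ha [Hab ->]]]]; auto.
  - exists (RInt f 1 1), 1, 1; repeat split; lra.
  - exists l; intros P [eps HP].
    assert (Hnear : exists a b, 0 < a /\ a <= b /\ l - eps < RInt f a b).
    { apply Classical_Prop.NNPP; intros Hn.
      assert (l <= l - eps); [|pose proof (cond_pos eps); lra].
      apply Hlub; intros y [a [b [Ha [Hab ->]]]].
      apply Rnot_lt_le; intros Hlt; apply Hn; now exists a, b. }
    destruct Hnear as [a0 [b0 [Ha0 [Hab0 Hl]]]].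
    apply (filter_prod_0_infty _ a0 b0); [exact Ha0|].
    intros a b Ha Hb; exists (RInt f a b); split.
    + apply (@RInt_correct R_CompleteNormedModule), Hex; lra.
    + apply HP.
      assert (RInt f a b <= l) by (apply Hub; exists a, b; repeat split; lra).
      assert (E1 : RInt f a a0 + RInt f a0 b = RInt f a b)
        by (apply (@RInt_Chasles R_CompleteNormedModule); apply Hex; lra).
      assert (E2 : RInt f a0 b0 + RInt f b0 b = RInt f a0 b)
        by (apply (@RInt_Chasles R_CompleteNormedModule); apply Hex; lra).
      assert (0 <= RInt f a a0)
        by (apply RInt_ge_0; [lra|apply Hex; lra|intros; apply Hpos; lra]).
      assert (0 <= RInt f b0 b)
        by (apply RInt_ge_0; [lra|apply Hex; lra|intros; apply Hpos; lra]).
      change (Rabs (RInt f a b - l) < eps).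
      apply Rabs_lt_between; pose proof (cond_pos eps); lra.
Qed.

Lemma exp_le_compat (x y : R) : x <= y -> exp x <= exp y.
Proof.
  intros [H| ->]; [left; now apply exp_increasing|lra].
Qed.

Definition Gamma_integrand (s t : R) : R := Rpower t (s - 1) * exp (- t).

(** Euler's integral as a relation: its convergence is then part of every
    statement, and it propagates from [s] to [s + 1] by the recurrence. *)
Definition is_Gamma (s l : R) : Prop := is_RInt_0_infty (Gamma_integrand s) l.

Lemma is_derive_Rpower (s t : R) :
  0 < t -> is_derive (fun t => Rpower t s) t (s * Rpower t (s - 1)).
Proof. intros Ht; now apply is_derive_Reals, derivable_pt_lim_power. Qed.

Lemma Rpower_pred (s t : R) : 0 < t -> Rpower t s = t * Rpower t (s - 1).
Proof.
  intros Ht; replace s with (1 + (s - 1)) at 1 by ring.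
  now rewrite Rpower_plus, Rpower_1.
Qed.

Lemma continuous_Gamma_integrand (s t : R) : 0 < t -> continuous (Gamma_integrand s) t.
Proof.
  intros Ht; unfold Gamma_integrand.
  apply (continuous_mult (fun t => Rpower t (s - 1)) (fun t => exp (- t))).
  - apply (ex_derive_continuous (fun t => Rpower t (s - 1))).
    eexists; now apply is_derive_Rpower.
  - apply (ex_derive_continuous (fun t => exp (- t))); auto_derive; easy.
Qed.

(** The substitution [u = t / (1 + t)] suggests the primitive
    [4 / s * (t / (1 + t)) ^ s], bounded by [4 / s]; its derivative
    [4 t ^ (s - 1) / (1 + t) ^ (s + 1)] dominates the integrand both at [0] and at
    infinity, as [(1 + t) ^ 2 <= 4 exp t]. *)
Lemma ex_Gamma (s : R) : 0 < s <= 1 -> exists l, is_Gamma s l.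
Proof.
  intros Hs.
  apply (ex_RInt_0_infty_dominated _ (fun t => 4 / s * Rpower (t / (1 + t)) s) (4 / s)).
  - apply continuous_Gamma_integrand.
  - intros t Ht; apply Rmult_le_pos; left; apply exp_pos.
  - intros t Ht.
    assert (Hu : 0 < t / (1 + t)) by (apply Rdiv_lt_0_compat; lra).
    exists (4 / s * (/ (1 + t) ^ 2 * (s * Rpower (t / (1 + t)) (s - 1)))); split.
    + apply (is_derive_scal (fun t => Rpower (t / (1 + t)) s)).
      apply (is_derive_comp (fun u => Rpower u s) (fun t => t / (1 + t))).
      * now apply is_derive_Rpower.
      * auto_derive; [lra|field; lra].
    + unfold Gamma_integrand.
      replace (4 / s * (/ (1 + t) ^ 2 * (s * Rpower (t / (1 + t)) (s - 1))))
        with (Rpower (t / (1 + t)) (s - 1) * (4 / (1 + t) ^ 2)) by (field; lra).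
      apply Rmult_le_compat; try (left; apply exp_pos).
      * unfold Rpower; apply exp_le_compat.
        (* s - 1 is nonpositive, so the power decreases from t / (1 + t) to t *)
        assert (ln (t / (1 + t)) <= ln t); [|nra].
        apply ln_le; [exact Hu|].
        apply Rle_div_l; nra.
      * rewrite exp_Ropp.
        apply Rmult_le_reg_l with (exp t); [apply exp_pos|].
        rewrite Rinv_r by (pose proof (exp_pos t); lra).
        assert (Hh : 1 + t / 2 <= exp (t / 2)) by apply exp_ineq1_le.
        assert (Hx : exp t = exp (t / 2) * exp (t / 2))
          by (rewrite <- exp_plus; f_equal; field).
        assert ((1 + t) ^ 2 <= 4 * exp t) by (rewrite Hx; nra).
        apply Rmult_le_reg_r with ((1 + t) ^ 2); [nra|].
        replace (exp t * (4 / (1 + t) ^ 2) * (1 + t) ^ 2) with (4 * exp t)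
          by (field; lra).
        lra.
  - intros t Ht.
    assert (0 < 4 / s) by (apply Rdiv_lt_0_compat; lra).
    split; [apply Rmult_le_pos; [lra|left; apply exp_pos]|].
    rewrite <- (Rmult_1_r (4 / s)) at 2; apply Rmult_le_compat_l; [lra|].
    apply Rle_trans with (exp 0); [apply exp_le_compat|rewrite exp_0; lra].
    assert (ln (t / (1 + t)) <= 0); [|nra].
    rewrite <- ln_1; apply ln_le; [apply Rdiv_lt_0_compat; lra|].
    apply Rle_div_l; lra.
Qed.

Lemma Rpower_lim_0 (s : R) :
  0 < s -> filterlim (fun t => Rpower t s * exp (- t)) (at_right 0) (locally 0).
Proof.
  intros Hs P [eps HP].
  assert (Hd : 0 < Rpower eps (/ s)) by apply exp_pos.
  exists (mkposreal _ Hd); intros t Ht Hpos.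
  change (Rabs (t - 0) < Rpower eps (/ s)) in Ht.
  rewrite Rminus_0_r, Rabs_pos_eq in Ht by lra.
  apply HP; change (Rabs (Rpower t s * exp (- t) - 0) < eps).
  pose proof (exp_pos (s * ln t)) as H1; fold (Rpower t s) in H1.
  assert (Hlt : Rpower t s < eps).
  { replace (pos eps) with (Rpower (Rpower eps (/ s)) s).
    - apply Rlt_Rpower_l; lra.
    - rewrite Rpower_mult, Rinv_l, Rpower_1; [easy|apply cond_pos|lra]. }
  pose proof (exp_pos (- t)).
  assert (exp (- t) <= 1) by (rewrite <- exp_0; apply exp_le_compat; lra).
  rewrite Rminus_0_r, Rabs_pos_eq by nra; nra.
Qed.

Lemma Rpower_exp_lim_infty (s : R) :
  0 < s ->
  filterlim (fun t => Rpower t s * exp (- t)) (Rbar_locally p_infty) (locally 0).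
Proof.
  intros Hs P [eps HP].
  set (K := exp (s * ln (2 * s))).
  assert (HK : 0 < K) by apply exp_pos.
  pose proof (cond_pos eps) as He.
  exists (2 * K / eps); intros t Ht.
  assert (Hpos : 0 < t).
  { apply Rlt_trans with (2 := Ht); apply Rdiv_lt_0_compat; lra. }
  apply HP; change (Rabs (Rpower t s * exp (- t) - 0) < eps).
  rewrite Rminus_0_r, Rabs_pos_eq
    by (apply Rmult_le_pos; left; apply exp_pos).
  unfold Rpower; rewrite <- exp_plus.
  (* the tangent to ln at 2 s gives s ln t - t <= s ln (2 s) - t / 2 *)
  assert (Hln : ln t - ln (2 * s) <= t / (2 * s) - 1).
  { rewrite <- ln_div by lra.
    apply ln_le_sub_1, Rdiv_lt_0_compat; lra. }
  apply Rle_lt_trans with (K * exp (- (t / 2))).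
  { unfold K; rewrite <- exp_plus; apply exp_le_compat.
    apply (Rmult_le_compat_l s) in Hln; [|lra].
    replace (s * (t / (2 * s) - 1)) with (t / 2 - s) in Hln by (field; lra).
    lra. }
  rewrite exp_Ropp.
  assert (Ht2 : t / 2 < exp (t / 2)) by (pose proof (exp_ineq1_le (t / 2)); lra).
  apply Rle_lt_trans with (K * / (t / 2)).
  { apply Rmult_le_compat_l; [lra|]; apply Rinv_le_contravar; lra. }
  replace (K * / (t / 2)) with (2 * K / t) by (field; lra).
  apply Rlt_div_l; [lra|]; apply Rlt_div_l in Ht; lra.
Qed.

(** Integration by parts with the primitive [t ^ s * exp (- t)], which vanishes at
    both ends. *)
Lemma is_Gamma_S (s l : R) : 0 < s -> is_Gamma s l -> is_Gamma (s + 1) (s * l).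
Proof.
  intros Hs Hl.
  assert (H0 : is_RInt_0_infty
    (fun t => s * Gamma_integrand s t - Gamma_integrand (s + 1) t) (0 - 0)).
  { apply (is_RInt_0_infty_primitive (fun t => Rpower t s * exp (- t))).
    - intros t Ht; unfold Gamma_integrand; replace (s + 1 - 1) with s by ring.
      evar_last.
      + apply (is_derive_mult (fun t => Rpower t s) (fun t => exp (- t)));
          [now apply is_derive_Rpower| |exact Rmult_comm].
        auto_derive; [easy|reflexivity].
      + unfold plus, mult; simpl; unfold mult; simpl; ring.
    - intros t Ht.
      apply (continuous_minus (fun t => s * Gamma_integrand s t)).
      + now apply (continuous_scal_r s (Gamma_integrand s)), continuous_Gamma_integrand.
      + now apply continuous_Gamma_integrand.
    - now apply Rpower_lim_0.
    - now apply Rpower_exp_lim_infty. }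
  pose proof (is_RInt_gen_minus _ _ _ _ (is_RInt_gen_scal _ s _ Hl) H0) as H.
  unfold is_Gamma.
  replace (s * l) with (minus (scal s l) (0 - 0))
    by (unfold minus, plus, opp, scal; simpl; unfold mult; simpl; ring).
  revert H; apply is_RInt_gen_ext.
  apply filter_forall; intros ab t _.
  unfold minus, plus, opp, scal; simpl; unfold mult; simpl; ring.
Qed.

Lemma is_Gamma_1 : is_Gamma 1 1.
Proof.
  unfold is_Gamma; replace 1 with (0 - (-1)) at 2 by ring.
  apply (is_RInt_0_infty_primitive (fun t => - exp (- t))).
  - intros t Ht; unfold Gamma_integrand.
    rewrite Rminus_diag, Rpower_O by exact Ht.
    auto_derive; [easy|ring].
  - apply continuous_Gamma_integrand.
  - replace (-1) with (- exp (- 0)) by (rewrite Ropp_0, exp_0; ring).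
    apply (filterlim_filter_le_1 (F := locally 0)).
    + apply filter_le_within.
    + apply (ex_derive_continuous (fun t => - exp (- t))); auto_derive; easy.
  - intros P [eps HP]; exists (/ eps); intros t Ht.
    pose proof (cond_pos eps) as He.
    assert (0 < / eps) by now apply Rinv_0_lt_compat.
    apply HP; change (Rabs (- exp (- t) - 0) < eps).
    rewrite Rminus_0_r, Rabs_Ropp, Rabs_pos_eq by (left; apply exp_pos).
    rewrite exp_Ropp, <- (Rinv_inv eps).
    apply Rinv_lt_contravar; [apply Rmult_lt_0_compat; [assumption|apply exp_pos]|].
    pose proof (exp_ineq1_le t); lra.
Qed.

Lemma is_Gamma_Gamma (s : R) : 0 < s <= 1 -> is_Gamma s (Gamma s).
Proof.
  intros Hs; destruct (ex_Gamma s Hs) as [l Hl].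
  replace (Gamma s) with l; [exact Hl|].
  symmetry; unfold Gamma.
  apply (@is_RInt_gen_unique R_CompleteNormedModule); [| |exact Hl];
    apply Proper_StrongProper; [apply at_right_proper_filter|].
  apply Rbar_locally_filter.
Qed.

Lemma is_Gamma_fact (n : nat) : is_Gamma (INR (n + 2)) (INR (fact (n + 1))).
Proof.
  induction n as [|n IH].
  - replace (INR (fact (0 + 1))) with (1 * 1) by (simpl; ring).
    replace (INR (0 + 2)) with (1 + 1) by (simpl; ring).
    apply is_Gamma_S; [lra|apply is_Gamma_1].
  - replace (INR (fact (S n + 1))) with (INR (n + 2) * INR (fact (n + 1))).
    + replace (INR (S n + 2)) with (INR (n + 2) + 1)
        by (rewrite <- S_INR; f_equal; lia).
      apply is_Gamma_S; [apply lt_0_INR; lia|exact IH].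
    + rewrite <- mult_INR; f_equal.
      replace (S n + 1)%nat with (S (n + 1)) by lia; simpl; lia.
Qed.

(** The recurrence iterated from [Gamma x], the product
    [x (x + 1) ... (x + n + 1)] being written with the factorial taken out. *)
Lemma is_Gamma_prod (x : R) (n : nat) :
  0 < x <= 1 ->
  is_Gamma (INR (n + 2) + x)
    (x * Gamma x * prod_f_R0 (fun i => 1 + x / INR (i + 1)) n * INR (fact (n + 1))).
Proof.
  intros Hx; induction n as [|n IH].
  - replace (x * Gamma x * prod_f_R0 (fun i => 1 + x / INR (i + 1)) 0 * INR (fact (0 + 1)))
      with ((x + 1) * (x * Gamma x)) by (simpl; field).
    replace (INR (0 + 2) + x) with (x + 1 + 1) by (simpl; ring).
    apply is_Gamma_S; [lra|]; apply is_Gamma_S; [lra|].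
    now apply is_Gamma_Gamma.
  - assert (0 < INR (n + 2)) by (apply lt_0_INR; lia).
    replace (INR (S n + 2) + x) with (INR (n + 2) + x + 1)
      by (replace (S n + 2)%nat with (S (n + 2)) by lia; rewrite S_INR; ring).
    replace (INR (fact (S n + 1))) with (INR (n + 2) * INR (fact (n + 1)))
      by (rewrite <- mult_INR; f_equal;
          replace (S n + 1)%nat with (S (n + 1)) by lia; simpl; lia).
    cbn [prod_f_R0]; replace (S n + 1)%nat with (n + 2)%nat by lia.
    match goal with IH : is_Gamma _ ?A |- is_Gamma _ ?B =>
      replace B with ((INR (n + 2) + x) * A) by (field; lra) end.
    apply is_Gamma_S; [lra|exact IH].
Qed.

(** The right-hand side is the tangent line at [t = M] to the concave function
    [t ^ p]. *)
Lemma Rpower_le_tangent (p M t : R) :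
  0 <= p <= 1 -> 0 < M -> 0 < t ->
  Rpower t p <= Rpower M p * ((1 - p) + p / M * t).
Proof.
  intros Hp HM Ht.
  set (y := ln t - ln M).
  assert (Hy : t / M = exp y)
    by (unfold y; rewrite <- ln_div, exp_ln; auto; apply Rdiv_lt_0_compat; lra).
  replace (p / M * t) with (p * exp y) by (rewrite <- Hy; field; lra).
  replace (Rpower t p) with (Rpower M p * exp (p * y))
    by (unfold Rpower, y; rewrite <- exp_plus; f_equal; ring).
  apply Rmult_le_compat_l; [left; apply exp_pos|].
  (* weighted mean of the tangent bounds of exp at p y, evaluated at 0 and at y *)
  pose proof (exp_ineq1_le (- (p * y))) as H0.
  pose proof (exp_ineq1_le ((1 - p) * y)) as H1.
  pose proof (exp_pos (p * y)) as Hpos.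
  assert (E0 : exp (p * y) * exp (- (p * y)) = 1)
    by (rewrite <- exp_plus, Rplus_opp_r; apply exp_0).
  assert (E1 : exp (p * y) * exp ((1 - p) * y) = exp y)
    by (rewrite <- exp_plus; f_equal; ring).
  apply (Rmult_le_compat_l (exp (p * y))) in H0; [|lra].
  apply (Rmult_le_compat_l (exp (p * y))) in H1; [|lra].
  rewrite E0 in H0; rewrite E1 in H1.
  apply (Rmult_le_compat_l (1 - p)) in H0; [|lra].
  apply (Rmult_le_compat_l p) in H1; [|lra].
  lra.
Qed.

(** Integrating the tangent bound at [t = s] against the integrand of [Gamma s]:
    the linear term averages to its value at [s] because
    [Gamma (s + 1) = s * Gamma s]. *)
Lemma Gamma_shift_le (s p A C : R) :
  0 < s -> 0 <= p <= 1 -> is_Gamma s A -> is_Gamma (s + p) C -> C <= Rpower s p * A.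
Proof.
  intros Hs Hp HA HC.
  pose proof (is_Gamma_S s A Hs HA) as HB.
  pose proof (is_RInt_gen_plus _ _ _ _
    (is_RInt_gen_scal _ (Rpower s p * (1 - p)) _ HA)
    (is_RInt_gen_scal _ (Rpower s p * (p / s)) _ HB)) as H.
  replace (Rpower s p * A) with
    (plus (scal (Rpower s p * (1 - p)) A) (scal (Rpower s p * (p / s)) (s * A)))
    by (unfold plus, scal; simpl; unfold mult; simpl; field; lra).
  apply (is_RInt_0_infty_le _ _ _ _ HC H).
  intros t Ht; unfold plus, scal; simpl; unfold mult; simpl; unfold Gamma_integrand.
  replace (Rpower t (s + p - 1)) with (Rpower t p * Rpower t (s - 1))
    by (rewrite <- Rpower_plus; f_equal; ring).
  replace (s + 1 - 1) with s by ring; rewrite (Rpower_pred s) by exact Ht.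
  pose proof (Rpower_le_tangent p s t Hp Hs Ht) as Htan.
  assert (0 < Rpower t (s - 1) * exp (- t)) by (apply Rmult_lt_0_compat; apply exp_pos).
  apply (Rmult_le_compat_r (Rpower t (s - 1) * exp (- t))) in Htan; lra.
Qed.

Lemma prod_1_plus_pos (x : R) (n : nat) :
  0 <= x -> 0 < prod_f_R0 (fun i => 1 + x / INR (i + 1)) n.
Proof.
  intros Hx; induction n as [|n IH]; cbn [prod_f_R0].
  - simpl; lra.
  - apply Rmult_lt_0_compat; [exact IH|].
    assert (0 <= x / INR (S n + 1))
      by (apply Rdiv_le_0_compat; [lra|apply lt_0_INR; lia]).
    lra.
Qed.

(** This is [Gamma (m + x) <= m ^ x * Gamma m] for [m = n + 2]. *)
Lemma Gamma_prod_upper (x : R) (n : nat) :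
  0 < x <= 1 ->
  x * Gamma x * prod_f_R0 (fun i => 1 + x / INR (i + 1)) n <= Rpower (INR (n + 2)) x.
Proof.
  intros Hx.
  apply Rmult_le_reg_r with (INR (fact (n + 1))); [apply INR_fact_lt_0|].
  apply (Gamma_shift_le (INR (n + 2)) x).
  - apply lt_0_INR; lia.
  - lra.
  - apply is_Gamma_fact.
  - now apply is_Gamma_prod.
Qed.

(** The same inequality, from [m + x] up to [m + 1]:
    [m * Gamma m = Gamma (m + 1) <= (m + x) ^ (1 - x) * Gamma (m + x)]. *)
Lemma Gamma_prod_lower (x : R) (n : nat) :
  0 < x <= 1 ->
  INR (n + 2) <= Rpower (INR (n + 2) + x) (1 - x)
                 * (x * Gamma x * prod_f_R0 (fun i => 1 + x / INR (i + 1)) n).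
Proof.
  intros Hx.
  assert (0 < INR (n + 2)) by (apply lt_0_INR; lia).
  apply Rmult_le_reg_r with (INR (fact (n + 1))); [apply INR_fact_lt_0|].
  rewrite Rmult_assoc.
  apply (Gamma_shift_le (INR (n + 2) + x) (1 - x)).
  - lra.
  - lra.
  - now apply is_Gamma_prod.
  - replace (INR (n + 2) + x + (1 - x)) with (INR (n + 2) + 1) by ring.
    apply is_Gamma_S; [assumption|apply is_Gamma_fact].
Qed.

Lemma Gamma_pos (x : R) : 0 < x <= 1 -> 0 < Gamma x.
Proof.
  intros Hx.
  pose proof (Gamma_prod_lower x 0 Hx) as H.
  assert (HQ := prod_1_plus_pos x 0 (Rlt_le _ _ (proj1 Hx))).
  set (Q := prod_f_R0 _ _) in *.
  assert (0 < INR (0 + 2)) by (apply lt_0_INR; lia).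
  set (p := Rpower _ _) in *.
  assert (Hp : 0 < p) by apply exp_pos.
  apply Rmult_lt_reg_l with (p * x * Q).
  - repeat apply Rmult_lt_0_compat; lra.
  - lra.
Qed.

(** Gauss's limit in logarithmic form.  The two bounds on the product differ by
    the factor [(1 + x / (n + 2)) ^ (1 - x)], which tends to [1]. *)
Lemma ln_Gamma_limit (x : R) :
  0 < x <= 1 ->
  is_lim_seq
    (fun n => x * ln (INR (n + 2)) - ln (prod_f_R0 (fun i => 1 + x / INR (i + 1)) n))
    (ln (x * Gamma x)).
Proof.
  intros Hx.
  assert (HG : 0 < x * Gamma x)
    by (apply Rmult_lt_0_compat; [lra|now apply Gamma_pos]).
  apply (is_lim_seq_le_le
           (fun _ => ln (x * Gamma x)) _
           (fun n => ln (x * Gamma x) + (1 - x) * x * / INR (S n)));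
    [|apply is_lim_seq_const|].
  - intros n; pose proof (prod_1_plus_pos x n (Rlt_le _ _ (proj1 Hx))) as HQ.
    pose proof (Gamma_prod_upper x n Hx) as Hup.
    pose proof (Gamma_prod_lower x n Hx) as Hlow.
    set (Q := prod_f_R0 _ _) in *.
    assert (Hn : 0 < INR (S n)) by (apply lt_0_INR; lia).
    assert (Hn2 : INR (n + 2) = INR (S n) + 1)
      by (rewrite plus_INR, (S_INR n); simpl; ring).
    apply ln_le in Hup; [|now apply Rmult_lt_0_compat].
    apply ln_le in Hlow; [|lra].
    rewrite ln_mult in Hup by assumption.
    rewrite ln_mult, (ln_mult (x * Gamma x)) in Hlow;
      [|assumption|assumption|apply exp_pos|now apply Rmult_lt_0_compat].
    unfold Rpower in Hup, Hlow; rewrite ln_exp in Hup, Hlow.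
    assert (Hln : ln (INR (n + 2) + x) <= ln (INR (n + 2)) + x * / INR (S n)).
    { replace (INR (n + 2) + x) with (INR (n + 2) * (1 + x / INR (n + 2)))
        by (field; lra).
      assert (0 < x / INR (n + 2)) by (apply Rdiv_lt_0_compat; lra).
      rewrite ln_mult by lra.
      apply Rplus_le_compat_l.
      apply Rle_trans with (x / INR (n + 2)).
      - pose proof (ln_le_sub_1 (1 + x / INR (n + 2))); lra.
      - apply Rmult_le_compat_l; [lra|]; apply Rinv_le_contravar; lra. }
    apply (Rmult_le_compat_l (1 - x)) in Hln; [|lra].
    split; lra.
  - replace (Finite (ln (x * Gamma x)))
      with (Finite (ln (x * Gamma x) + (1 - x) * x * 0)) by (f_equal; ring).
    apply is_lim_seq_plus'; [apply is_lim_seq_const|].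
    apply (is_lim_seq_scal_l _ ((1 - x) * x) 0), is_lim_seq_inv_INR_S.
Qed.

(** * Harmonic numbers *)

Definition harmonic (n : nat) : R := sum_n_m (fun k => 1 / INR k) 1 n.

Lemma harmonic_S (n : nat) : harmonic (S n) = harmonic n + / INR (S n).
Proof.
  unfold harmonic; rewrite sum_n_Sm by lia.
  change plus with Rplus; now rewrite <- (Rdiv_1_l (INR (S n))).
Qed.

Lemma harmonic_0 : harmonic 0 = 0.
Proof. unfold harmonic; now rewrite sum_n_m_zero by lia. Qed.

(** [Lim_seq] is total, so [euler_gamma] is the limit only once convergence is
    known: the sequence decreases and is nonnegative, both by comparing
    [ln (n + 1) - ln n] with [1 / n] and [1 / (n + 1)]. *)
Lemma euler_gamma_lim :
  is_lim_seq (fun n => harmonic (n + 1) - ln (INR (n + 1))) euler_gamma.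
Proof.
  set (u := fun n => harmonic n - ln (INR n)).
  assert (Hex : ex_finite_lim_seq (fun n => u (S n))).
  { apply ex_finite_lim_seq_decr with 0.
    - intros n; unfold u; rewrite (harmonic_S (S n)).
      assert (0 < INR (S n)) by (apply lt_0_INR; lia).
      assert (E : INR (S (S n)) = INR (S n) + 1) by apply S_INR.
      pose proof (ln_diff_le (INR (S n)) (INR (S (S n))) ltac:(lra) ltac:(lra)) as H1.
      replace ((INR (S n) - INR (S (S n))) / INR (S (S n)))
        with (- / INR (S (S n))) in H1 by (rewrite E; field; lra).
      lra.
    - assert (Hl : forall n, ln (INR (S n)) <= harmonic n).
      { induction n as [|n IH].
        - rewrite harmonic_0; simpl INR; rewrite ln_1; lra.
        - rewrite harmonic_S.
          assert (0 < INR (S n)) by (apply lt_0_INR; lia).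
          assert (E : INR (S (S n)) = INR (S n) + 1) by apply S_INR.
          pose proof (ln_diff_le (INR (S (S n))) (INR (S n)) ltac:(lra) ltac:(lra)) as H1.
          replace ((INR (S (S n)) - INR (S n)) / INR (S n))
            with (/ INR (S n)) in H1 by (rewrite E; field; lra).
          lra. }
      intros n; unfold u; specialize (Hl n); rewrite harmonic_S.
      assert (0 < / INR (S n)) by (apply Rinv_0_lt_compat, lt_0_INR; lia).
      lra. }
  destruct Hex as [l Hl].
  assert (Hu : is_lim_seq u l) by now apply is_lim_seq_incr_1.
  unfold euler_gamma; change (fun n => _) with u at 2.
  rewrite (is_lim_seq_unique _ _ Hu).
  apply (is_lim_seq_ext (fun n => u (S n))); [|exact Hl].
  intros n; unfold u; now replace (n + 1)%nat with (S n) by lia.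
Qed.

Definition odd_harmonic (n : nat) : R := sum_n (fun i => / INR (2 * i + 1)) n.

Lemma odd_harmonic_S (n : nat) :
  odd_harmonic (S n) = odd_harmonic n + / INR (2 * n + 3).
Proof.
  unfold odd_harmonic; rewrite sum_Sn.
  now replace (2 * S n + 1)%nat with (2 * n + 3)%nat by lia.
Qed.

Lemma odd_harmonic_0 : odd_harmonic 0 = 1.
Proof. unfold odd_harmonic; rewrite sum_O; simpl; field. Qed.

Lemma odd_harmonic_eq (n : nat) :
  odd_harmonic n = harmonic (2 * n + 2) - harmonic (n + 1) / 2.
Proof.
  induction n as [|n IH].
  - rewrite odd_harmonic_0; simpl (2 * 0 + 2)%nat; simpl (0 + 1)%nat.
    rewrite !harmonic_S, harmonic_0; simpl; field.
  - rewrite odd_harmonic_S, IH.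
    replace (2 * S n + 2)%nat with (S (S (2 * n + 2))) by lia.
    replace (S n + 1)%nat with (S (n + 1)) by lia.
    rewrite !harmonic_S.
    replace (2 * n + 3)%nat with (S (2 * n + 2)) by lia.
    replace (INR (S (S (2 * n + 2)))) with (2 * INR (S (n + 1)))
      by (rewrite !S_INR, !plus_INR, mult_INR; simpl; ring).
    assert (0 < INR (S (n + 1))) by (apply lt_0_INR; lia).
    assert (0 < INR (S (2 * n + 2))) by (apply lt_0_INR; lia).
    field; lra.
Qed.

Lemma odd_harmonic_lim :
  is_lim_seq (fun n => odd_harmonic n - ln (INR (n + 1)) / 2) (euler_gamma / 2 + ln 2).
Proof.
  apply (is_lim_seq_ext
    (fun n => (harmonic (2 * n + 1 + 1) - ln (INR (2 * n + 1 + 1)))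
              - (/ 2 * (harmonic (n + 1) - ln (INR (n + 1)))) + ln 2)).
  - intros n; rewrite odd_harmonic_eq.
    replace (2 * n + 1 + 1)%nat with (2 * n + 2)%nat by lia.
    replace (INR (2 * n + 2)) with (2 * INR (n + 1))
      by (rewrite !plus_INR, mult_INR; simpl; ring).
    rewrite ln_mult; [field|lra|apply lt_0_INR; lia].
  - replace (euler_gamma / 2 + ln 2)
      with (euler_gamma - / 2 * euler_gamma + ln 2) by field.
    apply is_lim_seq_plus'; [|apply is_lim_seq_const].
    apply is_lim_seq_minus'.
    + apply (is_lim_seq_subseq _ _ (fun n => (2 * n + 1)%nat) ) with (2 := euler_gamma_lim).
      apply eventually_subseq; intros n; lia.
    + apply (is_lim_seq_scal_l _ (/ 2) euler_gamma), euler_gamma_lim.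
Qed.

(** The Leibniz series with the terms after the first one grouped in pairs. *)
Lemma Leibniz_pairs :
  is_series (fun n => / INR (4 * n + 3) - / INR (4 * n + 5)) (1 - PI / 4).
Proof.
  apply (is_series_partial_sums _ (fun n => 1 - sum_f_R0 (tg_alt PI_tg) (2 * n + 2))).
  - assert (Hev : forall i, tg_alt PI_tg (2 * i + 1) = - / INR (4 * i + 3)).
    { intros i; unfold tg_alt, PI_tg.
      replace (2 * i + 1)%nat with (S (2 * i)) by lia.
      rewrite pow_1_odd; replace (2 * S (2 * i) + 1)%nat with (4 * i + 3)%nat by lia; ring. }
    assert (Hod : forall i, tg_alt PI_tg (2 * i + 2) = / INR (4 * i + 5)).
    { intros i; unfold tg_alt, PI_tg.
      replace (2 * i + 2)%nat with (2 * S i)%nat by lia.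
      rewrite pow_1_even; replace (2 * (2 * S i) + 1)%nat with (4 * i + 5)%nat by lia; ring. }
    assert (Hs : forall i, sum_f_R0 (tg_alt PI_tg) (2 * i + 2) =
              sum_f_R0 (tg_alt PI_tg) (2 * i) - / INR (4 * i + 3) + / INR (4 * i + 5)).
    { intros i; rewrite <- Hod.
      replace (- / INR (4 * i + 3)) with (tg_alt PI_tg (2 * i + 1)) by apply Hev.
      unfold Rminus; rewrite <- Hev.
      replace (2 * i + 2)%nat with (S (S (2 * i))) by lia.
      replace (2 * i + 1)%nat with (S (2 * i)) by lia; reflexivity. }
    induction n as [|n IH].
    + rewrite sum_O, Hs; change (2 * 0)%nat with 0%nat.
      cbn [sum_f_R0]; unfold tg_alt at 1, PI_tg at 1; simpl; field.
    + rewrite sum_Sn, <- IH, Hs; change plus with Rplus.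
      replace (2 * S n)%nat with (2 * n + 2)%nat by lia; ring.
  - apply is_lim_seq_minus'; [apply is_lim_seq_const|].
    rewrite <- Alt_PI_eq.
    apply (is_lim_seq_subseq (sum_f_R0 (tg_alt PI_tg)) _ (fun n => (2 * n + 2)%nat)).
    + apply eventually_subseq; intros n; lia.
    + apply is_lim_seq_Reals; unfold Alt_PI.
      destruct exist_PI as [l Hl]; now replace (4 * l / 4) with l by field.
Qed.

(** * Weighted sums of zeta values *)

Lemma ex_series_inv_pow (k : nat) :
  (2 <= k)%nat -> ex_series (fun n => / INR (n + 1) ^ k).
Proof.
  intros Hk.
  apply (@ex_series_le R_AbsRing R_CompleteNormedModule _
           (fun n => / INR (n + 1) ^ 2)); [|eexists; apply Basel].
  intros n; change norm with Rabs.
  assert (1 <= INR (n + 1)) by (rewrite plus_INR; simpl; pose proof (pos_INR n); lra).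
  rewrite Rabs_pos_eq by (left; apply Rinv_0_lt_compat, pow_lt; lra).
  apply Rinv_le_contravar; [apply pow_lt; lra|].
  now apply Rle_pow.
Qed.

Lemma zeta_minus_1_series (k : nat) :
  (2 <= k)%nat ->
  is_series (fun n => / INR (n + 2) ^ k) (zeta (INR k) - 1).
Proof.
  intros Hk.
  assert (H : is_series (fun n => / INR (n + 1) ^ k) (zeta (INR k))).
  { unfold zeta.
    rewrite (Series_ext _ (fun n => / INR (n + 1) ^ k)).
    - apply Series_correct, ex_series_inv_pow, Hk.
    - intros n; rewrite Rpower_Ropp, Rpower_pow; [easy|].
      apply lt_0_INR; lia. }
  apply (is_series_ext (fun n => / INR (S n + 1) ^ k)).
  { intros n; now replace (S n + 1)%nat with (n + 2)%nat by lia. }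
  apply (is_series_incr_1 (fun n => / INR (n + 1) ^ k)).
  change plus with Rplus; simpl (INR (0 + 1)).
  now replace (zeta (INR k) - 1 + / 1 ^ k) with (zeta (INR k))
    by (rewrite pow1; field).
Qed.

(** Expanding each [zeta k - 1] as a sum over [n >= 2] and exchanging the sums,
    the weighted sum of zeta values becomes the sum over [n] of the generating
    function of the weights at [x / n]. *)
Lemma sum_weighted_zeta_minus_1 (w g : nat -> R) (x S : R) :
  (forall j, 0 <= w j) -> 0 <= x ->
  (forall n, is_series (fun j => w j * (x / INR (n + 2)) ^ (j + 2)) (g n)) ->
  is_series g S ->
  is_series (fun j => w j * x ^ (j + 2) * (zeta (INR (j + 2)) - 1)) S.
Proof.
  intros Hw Hx Hg HS.
  apply (is_series_swap (fun n j => w j * (x / INR (n + 2)) ^ (j + 2)) g);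
    [|exact Hg| |exact HS].
  - intros n j; apply Rmult_le_pos; [apply Hw|].
    apply pow_le; apply Rdiv_le_0_compat; [exact Hx|apply lt_0_INR; lia].
  - intros j.
    apply (is_series_ext
             (fun n => scal (w j * x ^ (j + 2)) (/ INR (n + 2) ^ (j + 2)))).
    + intros n; unfold scal; simpl; unfold mult; simpl.
      unfold Rdiv; rewrite Rpow_mult_distr, pow_inv; ring.
    + apply (is_series_scal (w j * x ^ (j + 2)) (fun n => / INR (n + 2) ^ (j + 2))).
      apply zeta_minus_1_series; lia.
Qed.

Lemma Zfloor_half (k : nat) : IZR (Zfloor (INR k / 2)) = INR (Nat.div2 k).
Proof.
  rewrite (Zfloor_eq (Z.of_nat (Nat.div2 k))); rewrite <- INR_IZR_INZ; [easy|].
  rewrite (Nat.div2_odd k) at 2 3.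
  rewrite plus_INR, mult_INR; simpl (INR 2).
  destruct (Nat.odd k); simpl; lra.
Qed.

(** Since [div2 (n + 2) = div2 n + 1], the sum [s] satisfies
    [s = y ^ 2 * (s + 1 / (1 - y))]. *)
Lemma is_series_div2 (y : R) :
  0 <= y < 1 ->
  is_series (fun n => INR (Nat.div2 n) * y ^ n) (y ^ 2 / ((1 - y) ^ 2 * (1 + y))).
Proof.
  intros Hy.
  assert (Hgeom : is_series (fun n => y ^ n) (/ (1 - y)))
    by (apply is_series_geom; rewrite Rabs_pos_eq; lra).
  assert (Hex : ex_series (fun n => INR (Nat.div2 n) * y ^ n)).
  { assert (Hr : CV_radius (fun _ => 1) = 1).
    { rewrite (CV_radius_finite_DAlembert (fun _ => 1) 1).
      - now rewrite Rinv_1.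
      - intros _; lra.
      - lra.
      - apply (is_lim_seq_ext (fun _ => 1)); [|apply is_lim_seq_const].
        intros n; now rewrite Rdiv_1_r, Rabs_R1. }
    assert (Hd : ex_series (fun n => PS_derive (fun _ => 1) n * y ^ n)).
    { apply ex_pseries_R, ex_pseries_derive.
      rewrite Hr; simpl; rewrite Rabs_pos_eq; lra. }
    revert Hd; apply (@ex_series_le R_AbsRing R_CompleteNormedModule).
    intros n; change norm with Rabs; unfold PS_derive.
    assert (0 <= y ^ n) by (apply pow_le; lra).
    rewrite Rabs_pos_eq by (apply Rmult_le_pos; [apply pos_INR|assumption]).
    apply Rmult_le_compat_r; [assumption|].
    rewrite Rmult_1_r; apply le_INR.
    pose proof (Nat.div2_decr n (S n)); lia. }
  destruct Hex as [s Hs].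
  replace (y ^ 2 / ((1 - y) ^ 2 * (1 + y))) with s; [exact Hs|].
  (* shifting the index by 2 adds 1 to each coefficient *)
  assert (Hshift : is_series (fun n => INR (Nat.div2 n) * y ^ n)
                     (y ^ 2 * (s + / (1 - y)))).
  { apply is_series_decr_1; apply is_series_decr_1.
    unfold plus, opp; simpl.
    replace (y * (y * 1) * (s + / (1 - y)) + - (0 * 1) + - (0 * (y * 1)))
      with (y ^ 2 * (s + / (1 - y))) by ring.
    apply (is_series_ext
             (fun n => scal (y ^ 2) (plus (INR (Nat.div2 n) * y ^ n) (y ^ n)))).
    - intros n.
      change (y * (y * y ^ n)) with (y * (y * y ^ n)).
      replace (match Nat.div2 n with 0%nat => 1 | S _ => INR (Nat.div2 n) + 1 end)
        with (INR (Nat.div2 n) + 1) by (destruct (Nat.div2 n); simpl; ring).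
      unfold scal, plus; simpl; unfold mult; simpl; ring.
    - apply (@is_series_scal R_AbsRing R_NormedModule (y ^ 2) _ (s + / (1 - y))).
      now apply (is_series_plus (fun n => INR (Nat.div2 n) * y ^ n) (fun n => y ^ n)). }
  assert (Heq : s = y ^ 2 * (s + / (1 - y))).
  { rewrite <- (is_series_unique _ _ Hs) at 1.
    now apply is_series_unique. }
  apply Rmult_eq_reg_r with ((1 - y) ^ 2 * (1 + y));
    [|apply Rgt_not_eq, Rmult_lt_0_compat; [apply pow_lt|]; lra].
  replace (s * ((1 - y) ^ 2 * (1 + y)))
    with ((1 - y) * (s - y ^ 2 * s)) by ring.
  rewrite Heq at 1; field; lra.
Qed.

(** Both sides vanish at [0], and the derivative of the left-hand side is the
    previous generating function divided by [y]. *)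
Lemma is_series_div2_over (y : R) :
  0 < y < 1 ->
  is_series (fun n => INR (Nat.div2 n) / INR n * y ^ n)
    (y / (2 * (1 - y)) + ln ((1 - y) / (1 + y)) / 4).
Proof.
  intros Hy.
  set (a := fun n => INR (Nat.div2 n) / INR n).
  set (g := fun t => t / (2 * (1 - t)) + ln ((1 - t) / (1 + t)) / 4).
  assert (Ha : forall n, 0 <= a n <= 1).
  { intros [|n]; unfold a.
    - simpl; lra.
    - assert (0 < INR (S n)) by (apply lt_0_INR; lia).
      split; [apply Rdiv_le_0_compat; [apply pos_INR|assumption]|].
      apply Rle_div_l; [assumption|]; rewrite Rmult_1_l.
      apply le_INR; pose proof (Nat.div2_decr (S n) (S n)); lia. }
  assert (Hr : Rbar_le 1 (CV_radius a)).
  { apply (CV_radius_bounded a); exists 1; intros n.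
    rewrite pow1, Rmult_1_r, Rabs_pos_eq; apply Ha. }
  assert (Hrt : forall t, 0 <= t < 1 -> Rbar_lt (Rabs t) (CV_radius a)).
  { intros t Ht; apply Rbar_lt_le_trans with 1; [|exact Hr].
    simpl; rewrite Rabs_pos_eq; lra. }
  assert (Hex : ex_series (fun n => a n * y ^ n)).
  { apply ex_pseries_R, CV_radius_inside, Hrt; lra. }
  replace (y / (2 * (1 - y)) + ln ((1 - y) / (1 + y)) / 4) with (PSeries a y).
  { unfold PSeries; apply Series_correct, Hex. }
  change (PSeries a y = g y).
  assert (Hder : forall t, 0 <= t <= y ->
            is_derive (fun t => PSeries a t - g t) t 0).
  { intros t Ht.
    replace 0 with (PSeries (PS_derive a) t - t / ((1 - t) ^ 2 * (1 + t))).
    - apply (is_derive_minus (PSeries a) g).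
      + apply is_derive_PSeries, Hrt; lra.
      + unfold g; auto_derive.
        * repeat split; try lra; apply Rdiv_lt_0_compat; lra.
        * field; repeat split; lra.
    - apply Rminus_diag_eq.
      unfold PSeries; apply is_series_unique.
      destruct (Req_dec t 0) as [->|Ht0].
      { replace (0 / ((1 - 0) ^ 2 * (1 + 0))) with 0 by field.
        apply (is_series_ext (fun _ => 0)).
        - intros [|n]; [unfold PS_derive, a; simpl; field|simpl; ring].
        - apply (is_series_partial_sums _ (fun _ => 0)); [|apply is_lim_seq_const].
          intros n; unfold sum_n; rewrite sum_n_m_const; ring. }
      apply (is_series_ext (fun n => scal (/ t) (INR (Nat.div2 (S n)) * t ^ S n))).
      + intros n; unfold scal, PS_derive, a; simpl pow; cbn -[INR Nat.div2].
        unfold mult; cbn -[INR Nat.div2].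
        assert (INR (S n) <> 0) by (apply not_0_INR; lia).
        field; auto.
      + replace (t / ((1 - t) ^ 2 * (1 + t)))
          with (/ t * (t ^ 2 / ((1 - t) ^ 2 * (1 + t)))) by (field; lra).
        apply (@is_series_scal R_AbsRing R_NormedModule (/ t) _ (t ^ 2 / ((1 - t) ^ 2 * (1 + t)))).
        apply (is_series_incr_1 (fun n => INR (Nat.div2 n) * t ^ n)).
        unfold plus; simpl (INR (Nat.div2 0)); cbn -[pow].
        rewrite Rmult_0_l, Rplus_0_r.
        apply is_series_div2; lra. }
  pose proof (eq_is_derive (fun t => PSeries a t - g t) 0 y Hder (proj1 Hy)) as H0.
  cbv beta in H0.
  assert (PSeries a 0 = 0) as Ha0.
  { rewrite PSeries_0; unfold a; simpl; apply Rmult_0_l. }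
  assert (g 0 = 0) as Hg0.
  { unfold g; replace ((1 - 0) / (1 + 0)) with 1 by field; rewrite ln_1; field. }
  lra.
Qed.

(** The generating function of [div2 k / k]; it equals
    [(y / (1 - y) - arctanh y) / 2]. *)
Definition log_kernel (y : R) : R := y / (2 * (1 - y)) + ln ((1 - y) / (1 + y)) / 4.

Lemma sum_half_zeta_over (x S : R) :
  0 < x <= 1 ->
  is_series (fun n => log_kernel (x / INR (n + 2))) S ->
  is_series (fun j => INR (Nat.div2 (j + 2)) / INR (j + 2) * x ^ (j + 2)
                      * (zeta (INR (j + 2)) - 1)) S.
Proof.
  intros Hx HS.
  apply (sum_weighted_zeta_minus_1
           (fun j => INR (Nat.div2 (j + 2)) / INR (j + 2))
           (fun n => log_kernel (x / INR (n + 2)))); [|lra| |exact HS].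
  - intros j; apply Rdiv_le_0_compat; [apply pos_INR|apply lt_0_INR; lia].
  - intros n.
    apply (is_series_drop_2
             (fun k => INR (Nat.div2 k) / INR k * (x / INR (n + 2)) ^ k)).
    + simpl; unfold Rdiv; ring.
    + simpl; field; apply not_0_INR; lia.
    + apply is_series_div2_over.
      assert (2 <= INR (n + 2)) by (rewrite plus_INR; simpl; pose proof (pos_INR n); lra).
      split; [apply Rdiv_lt_0_compat; lra|apply Rlt_div_l; lra].
Qed.

(** * Summation of the generating functions *)

(** With [m = n + 2] the term is [m / ((m - 1) ^ 2 * (m + 1))], that is
    [1 / (2 (m - 1) ^ 2) + (1 / (m - 1) - 1 / (m + 1)) / 4]: a Basel series plus a
    telescoping one. *)
Lemma series_rational :
  is_series (fun n => (1 / INR (n + 2)) ^ 2 /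
               ((1 - 1 / INR (n + 2)) ^ 2 * (1 + 1 / INR (n + 2))))
    ((9 + 2 * PI ^ 2) / 24).
Proof.
  apply (is_series_partial_sums _
    (fun n => / 2 * sum_n (fun i => / INR (i + 1) ^ 2) n
              + / 4 * (3 / 2 - / (INR n + 2) - / (INR n + 3)))).
  - assert (Hterm : forall n, (1 / INR (n + 2)) ^ 2 /
               ((1 - 1 / INR (n + 2)) ^ 2 * (1 + 1 / INR (n + 2))) =
             / 2 * / INR (n + 1) ^ 2 + / 4 * (/ (INR n + 1) - / (INR n + 3))).
    { intros n; rewrite !plus_INR; simpl (INR 1); simpl (INR 2).
      pose proof (pos_INR n); field; lra. }
    induction n as [|n IH].
    + rewrite !sum_O, Hterm; simpl; field.
    + rewrite !sum_Sn, Hterm, <- IH; change plus with Rplus.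
      rewrite S_INR; pose proof (pos_INR n).
      rewrite !plus_INR, S_INR; simpl (INR 1).
      field; lra.
  - replace (Finite ((9 + 2 * PI ^ 2) / 24))
      with (Finite (/ 2 * (PI ^ 2 / 6) + / 4 * (3 / 2 - 0 - 0))) by (f_equal; field).
    apply is_lim_seq_plus'.
    + apply (is_lim_seq_scal_l _ (/ 2) (PI ^ 2 / 6)), Basel.
    + apply (is_lim_seq_scal_l _ (/ 4) (3 / 2 - 0 - 0)).
      apply is_lim_seq_minus'; [apply is_lim_seq_minus'; [apply is_lim_seq_const|]|];
        apply is_lim_seq_inv_shift; lra.
Qed.

(** The rational parts add up to half a harmonic number and the logarithms
    telescope; their growth, of half a logarithm each, cancels and leaves
    [euler_gamma / 2 + ln 2 / 4]. *)
Lemma series_log_kernel_1 :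
  is_series (fun n => log_kernel (1 / INR (n + 2))) ((2 * euler_gamma + ln 2) / 4).
Proof.
  apply (is_series_partial_sums _
    (fun n => / 2 * (harmonic (n + 1) - ln (INR (n + 1)))
              + / 4 * (ln (INR n + 1) - ln (INR n + 2))
              + / 4 * (ln (INR n + 1) - ln (INR n + 3)) + ln 2 / 4)).
  - assert (Hterm : forall n, log_kernel (1 / INR (n + 2)) =
      / 2 * / (INR n + 1) + / 4 * (ln (INR n + 1) - ln (INR n + 3))).
    { intros n; unfold log_kernel; pose proof (pos_INR n).
      rewrite plus_INR; simpl (INR 2).
      replace ((1 - 1 / (INR n + (1 + 1))) / (1 + 1 / (INR n + (1 + 1))))
        with ((INR n + 1) / (INR n + 3)) by (field; lra).
      rewrite ln_div by lra; field; lra. }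
    induction n as [|n IH].
    + rewrite sum_O, Hterm; simpl (0 + 1)%nat.
      rewrite harmonic_S, harmonic_0; simpl INR.
      rewrite !Rplus_0_l, ln_1; lra.
    + rewrite sum_Sn, <- IH, Hterm; change plus with Rplus.
      replace (S n + 1)%nat with (S (n + 1)) by lia.
      rewrite harmonic_S, !S_INR, !plus_INR; simpl (INR 1).
      replace (INR n + 1 + 2) with (INR n + 3) by ring.
      replace (INR n + 1 + 3) with (INR n + 4) by ring.
      replace (INR n + 1 + 1) with (INR n + 2) by ring.
      lra.
  - replace (Finite ((2 * euler_gamma + ln 2) / 4))
      with (Finite (/ 2 * euler_gamma + / 4 * 0 + / 4 * 0 + ln 2 / 4)) by (f_equal; field).
    apply is_lim_seq_plus'; [|apply is_lim_seq_const].
    apply is_lim_seq_plus'; [apply is_lim_seq_plus'|].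
    + apply (is_lim_seq_scal_l _ (/ 2) euler_gamma), euler_gamma_lim.
    + apply (is_lim_seq_scal_l _ (/ 4) 0), ln_shift_lim; lra.
    + apply (is_lim_seq_scal_l _ (/ 4) 0), ln_shift_lim; lra.
Qed.

(** As for [x = 1], with the odd denominators [2 m - 1] in place of [m - 1]. *)
Lemma series_log_kernel_half :
  is_series (fun n => log_kernel (1 / 2 / INR (n + 2))) ((euler_gamma + ln 6 - 2) / 4).
Proof.
  apply (is_series_partial_sums _
    (fun n => / 2 * (odd_harmonic (n + 1) - ln (INR (n + 1 + 1)) / 2)
              + / 4 * (ln (INR n + 2) - ln (INR n + 5 / 2))
              + ((ln 3 - ln 2) / 4 - / 2))).
  - assert (Hterm : forall n, log_kernel (1 / 2 / INR (n + 2)) =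
      / 2 * / (2 * INR n + 3) + / 4 * (ln (INR n + 3 / 2) - ln (INR n + 5 / 2))).
    { intros n; unfold log_kernel; pose proof (pos_INR n).
      rewrite plus_INR; simpl (INR 2).
      replace ((1 - 1 / 2 / (INR n + (1 + 1))) / (1 + 1 / 2 / (INR n + (1 + 1))))
        with ((INR n + 3 / 2) / (INR n + 5 / 2)) by (field; lra).
      rewrite ln_div by lra; field; lra. }
    induction n as [|n IH].
    + rewrite sum_O, Hterm; simpl (0 + 1)%nat.
      rewrite odd_harmonic_S, odd_harmonic_0; simpl INR.
      replace (0 + 3 / 2) with (3 / 2) by ring.
      rewrite (ln_div 3 2) by lra.
      replace (1 + 1) with 2 by ring.
      replace (0 + 2) with 2 by ring.
      replace (2 + 1) with 3 by ring.
      lra.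
    + rewrite sum_Sn, <- IH, Hterm; change plus with Rplus.
      replace (S n + 1)%nat with (S (n + 1)) by lia.
      rewrite odd_harmonic_S.
      replace (INR (2 * (n + 1) + 3)) with (2 * INR (S n) + 3)
        by (rewrite !plus_INR, mult_INR, plus_INR, S_INR; simpl; ring).
      rewrite !S_INR, !plus_INR; simpl (INR 1).
      rewrite S_INR, plus_INR; simpl (INR 1).
      replace (INR n + 1 + 1 + 1) with (INR n + 3) by ring.
      replace (INR n + 1 + 1) with (INR n + 2) by ring.
      replace (INR n + 1 + 2) with (INR n + 3) by ring.
      replace (INR n + 1 + 3 / 2) with (INR n + 5 / 2) by field.
      lra.
  - replace (Finite ((euler_gamma + ln 6 - 2) / 4))
      with (Finite (/ 2 * (euler_gamma / 2 + ln 2) + / 4 * 0 + ((ln 3 - ln 2) / 4 - / 2))).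
    2: { f_equal; replace 6 with (2 * 3) by ring; rewrite ln_mult by lra; field. }
    apply is_lim_seq_plus'; [apply is_lim_seq_plus'|apply is_lim_seq_const].
    + apply (is_lim_seq_scal_l _ (/ 2) (euler_gamma / 2 + ln 2)).
      apply (is_lim_seq_ext (fun n => odd_harmonic (S n) - ln (INR (S n + 1)) / 2)).
      { intros n; now replace (n + 1)%nat with (S n) by lia. }
      apply -> (is_lim_seq_incr_1 (fun n => odd_harmonic n - ln (INR (n + 1)) / 2)).
      apply odd_harmonic_lim.
    + apply (is_lim_seq_scal_l _ (/ 4) 0), ln_shift_lim; lra.
Qed.

(** Summing from [m = 1], the rational parts are [1 / (2 (4 m - 1))]; writing
    [1 / (4 m - 1)] as half the sum plus half the difference of [1 / (4 m - 1)] and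
    [1 / (4 m + 1)] gives an odd harmonic sum and the Leibniz series.  The
    logarithms are those of [(1 - y) / (1 + y) = (1 - y ^ 2) / (1 + y) ^ 2] with
    [y = 1 / (4 m)], hence governed by the sine product at [1 / 4] and by Gauss's
    limit for [Gamma (1 / 4)].  Removing the term [m = 1] accounts for
    [arctanh (1 / 4)] and [1 / 3]. *)
Lemma series_log_kernel_quarter :
  is_series (fun n => log_kernel (1 / 4 / INR (n + 2)))
    (1 / 2 * (ln (Gamma (1 / 4)) + euler_gamma / 4 + arctanh (1 / 4)
              - PI / 8 - 1 / 3 - 1 / 2 * ln (2 * PI))).
Proof.
  set (z := 1 / 4).
  assert (Hz : 0 < z <= 1) by (unfold z; lra).
  set (P := prod_f_R0 (fun i => 1 - (z / INR (i + 1)) ^ 2)).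
  set (Q := prod_f_R0 (fun i => 1 + z / INR (i + 1))).
  set (L := sum_n (fun n => / INR (4 * n + 3) - / INR (4 * n + 5))).
  assert (Hy : forall i, 0 < z / INR (i + 1) <= z).
  { intros i; assert (1 <= INR (i + 1)) by (rewrite plus_INR; simpl; pose proof (pos_INR i); lra).
    split; [apply Rdiv_lt_0_compat; lra|].
    apply Rle_div_l; [lra|nra]. }
  assert (HQ : forall n, 0 < Q n) by (intros n; apply prod_1_plus_pos; lra).
  assert (HP : forall n, 0 < P n).
  { induction n as [|n IH]; unfold P; cbn [prod_f_R0];
      [pose proof (Hy 0%nat)|pose proof (Hy (S n)); apply Rmult_lt_0_compat; [exact IH|]];
      unfold z in *; nra. }
  assert (HPI : 0 < PI) by apply PI_RGT_0.
  assert (Hsin : sin (PI * z) / (PI * z) = 4 / (sqrt 2 * PI)).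
  { unfold z; replace (PI * (1 / 4)) with (PI / 4) by field.
    rewrite sin_PI4.
    pose proof (sqrt_lt_R0 2 ltac:(lra)); field; lra. }
  assert (Hln : ln (4 / (sqrt 2 * PI)) = 3 / 2 * ln 2 - ln PI).
  { pose proof (sqrt_lt_R0 2 ltac:(lra)) as Hs2.
    rewrite ln_div, ln_mult by nra.
    replace 4 with (2 * 2) by ring; rewrite ln_mult by lra.
    assert (ln 2 = ln (sqrt 2) + ln (sqrt 2))
      by (rewrite <- ln_mult, sqrt_sqrt by lra; easy).
    lra. }
  assert (Hfull : is_series (fun n => log_kernel (z / INR (n + 1)))
    (1 / 2 * (ln (Gamma z) + euler_gamma / 4 - PI / 8 - 1 / 2 * ln (2 * PI)))).
  { apply (is_series_partial_sums _ (fun n =>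
      / 4 * L n
      + / 4 * (odd_harmonic (2 * n + 2) - ln (INR (2 * n + 2 + 1)) / 2)
      + / 4 * ln (P n)
      + / 2 * (z * ln (INR (n + 2)) - ln (Q n))
      + / 8 * (ln (INR n + 3 / 2) - ln (INR n + 2))
      + (ln 2 / 8 - / 4))).
    - assert (Hterm : forall n, log_kernel (z / INR (n + 1)) =
        / 2 * / INR (4 * n + 3) + / 4 * (ln (1 - (z / INR (n + 1)) ^ 2))
        - / 2 * ln (1 + z / INR (n + 1))).
      { intros n; unfold log_kernel; specialize (Hy n).
        replace ((1 - z / INR (n + 1)) / (1 + z / INR (n + 1)))
          with ((1 - (z / INR (n + 1)) ^ 2) / ((1 + z / INR (n + 1)) * (1 + z / INR (n + 1))))
          by (field; pose proof (lt_0_INR (n + 1) ltac:(lia)); lra).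
        rewrite ln_div by (unfold z in *; nra).
        rewrite ln_mult by lra.
        replace (z / INR (n + 1) / (2 * (1 - z / INR (n + 1))))
          with (/ 2 * / INR (4 * n + 3)).
        - field; apply not_0_INR; lia.
        - unfold z; rewrite !plus_INR, mult_INR; simpl INR.
          pose proof (pos_INR n); field; lra. }
      assert (Hsum : forall n, sum_n (fun i => log_kernel (z / INR (i + 1))) n =
        / 4 * L n + / 4 * (odd_harmonic (2 * n + 2) - 1) + / 4 * ln (P n) - / 2 * ln (Q n)).
      { induction n as [|n IH].
        - unfold L; rewrite !sum_O, Hterm; unfold P, Q; cbn [prod_f_R0].
          replace (2 * 0 + 2)%nat with 2%nat by lia.
          rewrite !odd_harmonic_S, odd_harmonic_0.
          replace (2 * 0 + 3)%nat with 3%nat by lia.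
          replace (2 * 1 + 3)%nat with 5%nat by lia.
          replace (4 * 0 + 3)%nat with 3%nat by lia.
          replace (4 * 0 + 5)%nat with 5%nat by lia.
          lra.
        - rewrite sum_Sn, IH, Hterm; change plus with Rplus.
          unfold L; rewrite sum_Sn; change plus with Rplus; fold (L n).
          replace (2 * S n + 2)%nat with (S (S (2 * n + 2))) by lia.
          rewrite !odd_harmonic_S.
          replace (2 * (2 * n + 2) + 3)%nat with (4 * S n + 3)%nat by lia.
          replace (2 * S (2 * n + 2) + 3)%nat with (4 * S n + 5)%nat by lia.
          replace (P (S n)) with (P n * (1 - (z / INR (S n + 1)) ^ 2)) by reflexivity.
          replace (Q (S n)) with (Q n * (1 + z / INR (S n + 1))) by reflexivity.
          specialize (Hy (S n)).
          rewrite (ln_mult (P n)) by (try apply HP; unfold z in *; nra).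
          rewrite (ln_mult (Q n)) by (try apply HQ; lra).
          lra. }
      intros n; rewrite Hsum.
      replace (INR (2 * n + 2 + 1)) with (2 * (INR n + 3 / 2))
        by (rewrite !plus_INR, mult_INR; simpl; field).
      pose proof (pos_INR n).
      rewrite ln_mult by lra.
      replace (INR (n + 2)) with (INR n + 2) by (rewrite plus_INR; simpl; ring).
      unfold z; lra.
    - pose proof (Gamma_pos z Hz) as HG.
      replace (Finite (1 / 2 * (ln (Gamma z) + euler_gamma / 4 - PI / 8 - 1 / 2 * ln (2 * PI))))
        with (Finite (/ 4 * (1 - PI / 4) + / 4 * (euler_gamma / 2 + ln 2)
                      + / 4 * ln (sin (PI * z) / (PI * z))
                      + / 2 * ln (z * Gamma z) + / 8 * 0 + (ln 2 / 8 - / 4))).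
      2: { rewrite Hsin, Hln; f_equal.
           rewrite (ln_mult z), (ln_mult 2) by lra.
           assert (Hlz : ln z = - 2 * ln 2).
           { unfold z, Rdiv; rewrite Rmult_1_l, ln_Rinv by lra.
             replace 4 with (2 * 2) by ring; rewrite ln_mult by lra; ring. }
           rewrite Hlz; field. }
      apply is_lim_seq_plus'; [|apply is_lim_seq_const].
      apply is_lim_seq_plus';
        [apply is_lim_seq_plus'; [apply is_lim_seq_plus'; [apply is_lim_seq_plus'|]|]|].
      + apply (is_lim_seq_scal_l _ (/ 4) (1 - PI / 4)), Leibniz_pairs.
      + apply (is_lim_seq_scal_l _ (/ 4) (euler_gamma / 2 + ln 2)).
        apply (is_lim_seq_subseq _ _ (fun n => (2 * n + 2)%nat)) with (2 := odd_harmonic_lim).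
        apply eventually_subseq; intros n; lia.
      + apply (is_lim_seq_scal_l _ (/ 4) (ln (sin (PI * z) / (PI * z)))).
        apply (is_lim_seq_continuous ln).
        * apply derivable_continuous_pt; exists (/ (sin (PI * z) / (PI * z))).
          apply derivable_pt_lim_ln; rewrite Hsin.
          pose proof (sqrt_lt_R0 2 ltac:(lra)).
          apply Rdiv_lt_0_compat; [lra|now apply Rmult_lt_0_compat].
        * apply sine_product; lra.
      + apply (is_lim_seq_scal_l _ (/ 2) (ln (z * Gamma z))), ln_Gamma_limit, Hz.
      + apply (is_lim_seq_scal_l _ (/ 8) 0), ln_shift_lim; lra. }
  apply (is_series_ext (fun n => log_kernel (z / INR (S n + 1)))).
  { intros n; now replace (S n + 1)%nat with (n + 2)%nat by lia. }
  apply (is_series_incr_1 (fun n => log_kernel (z / INR (n + 1)))).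
  change plus with Rplus.
  assert (E : log_kernel (z / INR (0 + 1)) = 1 / 6 - arctanh z / 2).
  { unfold log_kernel, arctanh; simpl INR.
    replace (z / 1) with z by field.
    replace ((1 - z) / (1 + z)) with (/ ((1 + z) / (1 - z))) by (unfold z; field).
    rewrite ln_Rinv by (unfold z; lra).
    unfold z at 1 2; lra. }
  rewrite E.
  match goal with H : is_series _ ?a |- is_series _ ?b =>
    replace b with a by field end.
  exact Hfull.
Qed.

Theorem proposition15 :
  is_series
    (fun j : nat => let k := (j + 2)%nat in
       IZR (Zfloor (INR k / 2)) * (zeta (INR k) - 1))
    ((9 + 2 * PI ^ 2) / 24)
  /\
  is_series
    (fun j : nat => let k := (j + 2)%nat in
       IZR (Zfloor (INR k / 2)) * ((zeta (INR k) - 1) / INR k))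
    ((2 * euler_gamma + ln 2) / 4)
  /\
  is_series
    (fun j : nat => let k := (j + 2)%nat in
       IZR (Zfloor (INR k / 2)) * ((zeta (INR k) - 1) / (INR k * 2 ^ k)))
    ((euler_gamma + ln 6 - 2) / 4)
  /\
  is_series
    (fun j : nat => let k := (j + 2)%nat in
       IZR (Zfloor (INR k / 2)) * ((zeta (INR k) - 1) / (INR k * 2 ^ (2 * k))))
    (1 / 2 * (ln (Gamma (1 / 4)) + euler_gamma / 4 + arctanh (1 / 4)
              - PI / 8 - 1 / 3 - 1 / 2 * ln (2 * PI))).
Proof.
  assert (HINR : forall j, INR (j + 2) <> 0) by (intros j; apply not_0_INR; lia).
  assert (Hpow : forall k, 2 ^ k <> 0) by (intros k; apply pow_nonzero; lra).
  repeat split.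
  - eapply is_series_ext_R.
    2: { apply (sum_weighted_zeta_minus_1 (fun j => INR (Nat.div2 (j + 2)))
                  (fun n => (1 / INR (n + 2)) ^ 2 /
                     ((1 - 1 / INR (n + 2)) ^ 2 * (1 + 1 / INR (n + 2)))) 1);
           [intros; apply pos_INR|lra| |apply series_rational].
         intros n.
         apply (is_series_drop_2 (fun k => INR (Nat.div2 k) * (1 / INR (n + 2)) ^ k)).
         - simpl; ring.
         - simpl; ring.
         - apply is_series_div2.
           assert (2 <= INR (n + 2)) by (rewrite plus_INR; simpl; pose proof (pos_INR n); lra).
           split; [apply Rdiv_le_0_compat; lra|apply Rlt_div_l; lra]. }
    intros j; cbv beta zeta; rewrite Zfloor_half, pow1; ring.
  - eapply is_series_ext_R.
    2: { apply (sum_half_zeta_over 1); [lra|apply series_log_kernel_1]. }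
    intros j; cbv beta zeta; rewrite Zfloor_half, pow1; field; apply HINR.
  - eapply is_series_ext_R.
    2: { apply (sum_half_zeta_over (1 / 2)); [lra|apply series_log_kernel_half]. }
    intros j; cbv beta zeta; rewrite Zfloor_half.
    unfold Rdiv; rewrite Rmult_1_l, pow_inv; field; auto.
  - eapply is_series_ext_R.
    2: { apply (sum_half_zeta_over (1 / 4)); [lra|apply series_log_kernel_quarter]. }
    intros j; cbv beta zeta; rewrite Zfloor_half.
    rewrite pow_mult; replace (2 ^ 2) with 4 by ring.
    assert (4 ^ (j + 2) <> 0) by (apply pow_nonzero; lra).
    unfold Rdiv; rewrite Rmult_1_l, pow_inv; field; auto.
Qed.
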